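(* Up to isomorphism, there are exactly 18 fullerene graphs with 60 vertices whose Clar number equals $\frac{60-12}{6}=8$. One of them is the buckminsterfullerene $\text{C}_{60}$, the fullerene graph on 60 vertices in which no two pentagonal faces share an edge.
   Context: A fullerene graph is a cubic 3-connected plane graph all of whose faces are pentagons or hexagons. Such a graph has exactly 12 pentagonal faces. Let $F$ be a fullerene graph. A set $\mathcal H$ of pairwise vertex-disjoint hexagonal faces of $F$ is a sextet pattern if $F$ has a perfect matching $M$ such that every hexagon in $\mathcal H$ is $M$-alternating; equivalently, $F-V(\mathcal H)$ has a perfect matching. The Clar number $c(F)$ is the maximum cardinality of a sextet pattern of $F$. A fullerene graph $F_n$ with $n$ vertices always satisfies $c(F_n)\le \lfloor (n-12)/6\rfloor$. It is called extremal if $c(F_n)=\frac{n-12}{6}$. The theorem says there are exactly 18 extremal fullerene graphs with 60 vertices. *)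

(* Defs.v *)
From mathcomp Require Import all_boot fingroup perm.

Set Implicit Arguments.
Unset Strict Implicit.
Unset Printing Implicit Defensive.

(** * Finite simple graphs *)

Record sgraph := SGraph {
  vertex :> finType;
  adj : rel vertex;
  adj_sym : symmetric adj;
  adj_irrefl : irreflexive adj }.

Section Graphs.
Variable G : sgraph.

Definition edges : {set {set G}} :=
  [set [set p.1; p.2] | p in [set p : G * G | adj p.1 p.2]].

Definition cubic := [forall x : G, #|[set y | adj x y]| == 3].

Definition connected_off (S : {set G}) :=
  [forall x, forall y, (x \notin S) ==> (y \notin S) ==>
     connect [rel u v | [&& adj u v, u \notin S & v \notin S]] x y].

Definition connected := connected_off set0.

Definition three_connected :=
  (3 < #|G|) && [forall S : {set G}, (#|S| < 3) ==> connected_off S].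

Definition perfect_matching (M : {set {set G}}) :=
  (M \subset edges) && [forall v : G, #|[set e in M | v \in e]| == 1].

Definition dart : finType := {d : G * G | adj d.1 d.2}.

Definition src (d : dart) : G := (val d).1.
Definition tgt (d : dart) : G := (val d).2.
Definition dart_edge (d : dart) : {set G} := [set src d; tgt d].

Lemma rev_dart_proof (d : dart) : adj (tgt d) (src d).
Proof. by rewrite adj_sym; exact: (valP d). Qed.

Definition rev_dart (d : dart) : dart := exist _ (tgt d, src d) (rev_dart_proof d).

Lemma rev_dartK : involutive rev_dart.
Proof. by case=> [[x y] xy]; apply: val_inj. Qed.

Definition rev_perm : {perm dart} := perm (can_inj rev_dartK).

End Graphs.

Definition graph_iso (G1 G2 : sgraph) : Prop :=
  exists2 f : G1 -> G2, bijective f & forall x y, adj (f x) (f y) = adj x y.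

(** * Plane graphs

   A cellular embedding of a connected graph in an oriented closed surface is
   given, up to homeomorphism, by a rotation system: the cyclic order in which
   the edges leave each vertex. *)

Record embedded_graph := EmbeddedGraph {
  graph :> sgraph;
  rotation : {perm dart graph};
  rotationP : forall d d', (d' \in porbit rotation d) = (src d' == src d) }.

Section Embedded.
Variable G : embedded_graph.

(* [perm] composition is read left to right: [face_perm d = rotation (rev_dart d)]
   is the dart that follows [d] along the boundary of the face beside [d]. *)
Definition face_perm : {perm dart G} := (rev_perm G * rotation G)%g.

(* A face is represented by the darts of its boundary walk. *)
Definition faces : {set {set dart G}} := porbits face_perm.

Definition face_vertices (f : {set dart G}) : {set G} := [set src d | d in f].
Definition face_edges (f : {set dart G}) : {set {set G}} :=
  [set dart_edge d | d in f].

(* For a connected graph with at least one edge, Euler's formula says that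
   the surface is the sphere. *)
Definition plane := connected G && (#|G| + #|faces| == #|edges G| + 2).

(* In a 3-connected plane graph every boundary walk is a cycle, so a face with
   [k] darts is bounded by a [k]-gon. *)
Definition kgonal_faces (k : nat) : {set {set dart G}} :=
  [set f in faces | #|f| == k].
Definition pentagons := kgonal_faces 5.
Definition hexagons := kgonal_faces 6.

Definition fullerene :=
  [&& plane, cubic G, three_connected G & faces == pentagons :|: hexagons].

(* Of any two consecutive edges on the boundary of [f], exactly one is in [M]. *)
Definition alternating (M : {set {set G}}) (f : {set dart G}) :=
  [forall d in f, (dart_edge d \in M) != (dart_edge (face_perm d) \in M)].

Definition sextet_pattern (H : {set {set dart G}}) :=
  [&& H \subset hexagons,
      [forall f in H, forall g in H,
         (f != g) ==> [disjoint face_vertices f & face_vertices g]]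
    & [exists M : {set {set G}},
         perfect_matching M && [forall f in H, alternating M f]]].

Definition clar_number : nat :=
  \max_(H : {set {set dart G}} | sextet_pattern H) #|H|.

Definition isolated_pentagons :=
  [forall f in pentagons, forall g in pentagons,
     (f != g) ==> [disjoint face_edges f & face_edges g]].

End Embedded.

Definition fullerene60 (G : embedded_graph) := fullerene G && (#|G| == 60).

Definition extremal60 (G : embedded_graph) :=
  fullerene60 G && (clar_number G == (60 - 12) %/ 6).

(* The property that singles out C60 among the fullerene graphs, together
   with its uniqueness. *)
Definition is_buckminsterfullerene (B : embedded_graph) : Prop :=
  [/\ fullerene60 B, isolated_pentagons B &
      forall G : embedded_graph,
        fullerene60 G -> isolated_pentagons G -> graph_iso G B].

(* Main.v *)
From HB Require Import structures.
Require Import Defs.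
From mathcomp Require Import all_boot fingroup perm zify.

(* Let [H] be a sextet pattern of a fullerene [G] with 60 vertices, with a perfect
   matching that alternates on its hexagons, and let [A] be the set of the matching
   edges off the hexagons. Call an edge a link if it lies neither on a hexagon of
   [H] nor in [A], and say that an edge of [A] exits through a face that contains
   exactly one of its ends. On the boundary of a face outside [H], links alternate
   with the other edges except at exits, so every pentagon has an odd number of
   exits. There are [2 #|A| = 60 - 6 #|H|] exits and 12 pentagons, hence
   [#|H| <= 8], and in the extremal case the exits correspond to the pentagons.
   Contracting the hexagons of [H] and the edges of [A] then leaves a triangulation
   with 8 vertices of degree 6, 6 vertices of degree 4 and the links as edges: every
   extremal [G] is obtained by gluing eight hexagons and six edges along their
   outgoing half-links, in such a way that three half-link rotations close up around
   every triangle. A backtracking search runs through these gluings; each complete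
   one with 72 half-links is isomorphic to one of 18 explicit graphs. In a fullerene
   with 60 vertices and isolated pentagons the pentagons cover all vertices, and the
   same argument with twelve pentagons in place of [H] leaves a single gluing. *)

Set Implicit Arguments.
Unset Strict Implicit.
Unset Printing Implicit Defensive.

(** * Cubic maps *)

(** Of the search only completeness is proved: a predicate that holds at every leaf holds for some
    table that the given graph realizes, so a test evaluated on all leaves transfers to all graphs.
    The numbers of the contracted triangulation fit: 8 * 6 + 6 * 4 = 72 half-links, hence 36 = 3 *
    14 - 6 edges, and 24 triangles, namely the 12 pentagons and the 12 hexagons outside [H]. A
    gluing may also close with fewer half-links; a connected [G] is filled by any closed table that
    it realizes, so the count 72 rules such a gluing out. On the side of existence the obstacle is
    that 3-connectivity, faces and perfect matchings quantify over sets and cannot be evaluated as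
    defined. Tests on neighbour tables replace them: cycles around the vertices, a count of pentagon
    darts for the Euler relation, and a matching built into the vertex numbering. Isomorphism
    concerns abstract graphs, so mirror images count as one, and non-isomorphism is read off a
    numerical invariant. *)

Section Orbits.
Variables (T : finType) (s : {perm T}).

Lemma iter_porbit_inj x i j : i < #|porbit s x| -> j < #|porbit s x| ->
  iter i s x = iter j s x -> i = j.
Proof.
move=> ilt jlt e.
have /(nth_uniq x) U := uniq_traject_porbit s x.
apply/eqP; rewrite -(U i j) ?size_traject // !nth_traject //; exact/eqP.
Qed.

Lemma card_porbit_min x k : 0 < k -> iter k s x = x ->
  (forall j, 0 < j < k -> iter j s x <> x) -> #|porbit s x| = k.
Proof.
move=> k0 kx kmin; have c0 : 0 < #|porbit s x| by rewrite lt0n card_porbit_neq0.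
case: (ltngtP #|porbit s x| k) => // [lt | gt].
  by case: (kmin #|porbit s x|); rewrite ?c0 ?lt // iter_porbit.
by have := iter_porbit_inj gt c0 kx => e; rewrite e in k0.
Qed.

Lemma porbit_iter x i : porbit s (iter i s x) = porbit s x.
Proof. by rewrite -permX porbit_perm. Qed.

Lemma porbit_step x : porbit s (s x) = porbit s x.
Proof. exact: (porbit_iter x 1). Qed.

Lemma porbit_iterP x y : y \in porbit s x ->
  exists2 i, i < #|porbit s x| & y = iter i s x.
Proof.
rewrite porbit_traject => /trajectP [i ilt ->]; by exists i.
Qed.

Lemma mem_porbit_eq x y : (y \in porbit s x) = (porbit s y == porbit s x).
Proof. by rewrite eq_porbit_mem. Qed.

Lemma porbits_mem f x : f \in porbits s -> x \in f -> f = porbit s x.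
Proof.
by case/imsetP=> y _ -> ; rewrite mem_porbit_eq => /eqP.
Qed.

Lemma card_porbits_uniform (C : {set {set T}}) k : C \subset porbits s ->
  (forall f, f \in C -> #|f| = k) -> #|[set x | porbit s x \in C]| = #|C| * k.
Proof.
move=> sub unif; rewrite -sum1_card.
rewrite (partition_big (porbit s) (mem C)) /=; last by move=> x; rewrite inE.
rewrite -sum_nat_const; apply: eq_bigr => f fC; rewrite -(unif f fC) -sum1_card.
apply: eq_bigl => x; rewrite inE.
have [y _ ef] := imsetP (subsetP sub f fC); rewrite ef mem_porbit_eq.
by rewrite andb_idl // => /eqP ->; rewrite -ef.
Qed.

Lemma card_porbits_size k :
  #|[set f in porbits s | #|f| == k]| * k = #|[set x | #|porbit s x| == k]|.
Proof.
rewrite -card_porbits_uniform; first 1 last.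
- by apply/subsetP=> f; rewrite inE => /andP [].
- by move=> f; rewrite inE => /andP [_ /eqP].
by apply: eq_card => x; rewrite !inE imset_f.
Qed.

End Orbits.

Section Darts.
Variable G : sgraph.
Local Notation dt := (dart G).
Local Notation e := (@rev_dart G).

Lemma revK d : e (e d) = d. Proof. exact: rev_dartK. Qed.
Lemma src_rev d : src (e d) = tgt d. Proof. by []. Qed.
Lemma tgt_rev d : tgt (e d) = src d. Proof. by []. Qed.

Lemma dart_inj (d d' : dt) : src d = src d' -> tgt d = tgt d' -> d = d'.
Proof.
by move=> es et; apply: val_inj; rewrite [val d]surjective_pairing
  [val d']surjective_pairing; congr pair.
Qed.

Lemma src_neq_tgt (d : dt) : src d != tgt d.
Proof.
by apply/eqP=> es; have := valP d; rewrite -/(src d) -/(tgt d) es adj_irrefl.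
Qed.

Lemma rev_neq d : e d <> d.
Proof. by move=> ed; have := src_neq_tgt d; rewrite -src_rev ed eqxx. Qed.

Lemma dart_edge_eq d d' : dart_edge d' = dart_edge d -> d' = d \/ d' = e d.
Proof.
move/setP=> h; have := h (src d'); have := h (tgt d'); have := h (src d).
rewrite !inE !eqxx ?orbT /= => h1 /esym h2 /esym h3.
have := src_neq_tgt d'; case/orP: h3 => /eqP e3; case/orP: h2 => /eqP e2.
- by rewrite e2 e3 eqxx.
- by left; apply: dart_inj.
- by right; apply: dart_inj.
- by rewrite e2 e3 eqxx.
Qed.

Lemma dart_edge_rev d : dart_edge (e d) = dart_edge d.
Proof. by rewrite /dart_edge src_rev tgt_rev setUC. Qed.

Lemma edgesP E : reflect (exists d : dt, E = dart_edge d) (E \in edges G).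
Proof.
apply: (iffP imsetP) => [[[x y]]|[d ->]].
  by rewrite inE /= => a ->; exists (exist _ (x, y) a : dt).
by exists (val d) => //; rewrite inE; exact: (valP d).
Qed.

End Darts.

Section Cubic.
Variable G : embedded_graph.
Hypothesis cubicG : cubic G.

Local Notation dt := (dart G).
Local Notation r := (rotation G).
Local Notation e := (@rev_dart G).
Local Notation phi := (face_perm G).

Lemma face_permE d : phi d = r (e d).
Proof. by rewrite permM permE. Qed.

Lemma card_out (v : G) : #|[set d : dt | src d == v]| = 3.
Proof.
have /forallP/(_ v)/eqP <- := cubicG.
rewrite -(card_in_imset (f := @tgt G)); last first.
  by move=> d d'; rewrite !inE => /eqP sv /eqP sv'; apply: dart_inj; rewrite sv.
apply: eq_card => w; rewrite inE; apply/imsetP/idP.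
  by case=> d; rewrite inE => /eqP <- ->; exact: (valP d).
by move=> a; exists (exist _ (v, w) a : dt); rewrite ?inE.
Qed.

Lemma src_rot d : src (r d) = src d.
Proof. by apply/eqP; rewrite -rotationP (mem_porbit _ 1). Qed.

Lemma card_rot d : #|porbit r d| = 3.
Proof.
by rewrite -(card_out (src d)); apply: eq_card => d'; rewrite inE rotationP.
Qed.

Lemma rot3 d : r (r (r d)) = d.
Proof. by have := iter_porbit r d; rewrite card_rot. Qed.

Lemma rot_neq d : r d <> d.
Proof. by move=> h; have := @iter_porbit_inj _ r d 1 0; rewrite card_rot => /(_ isT isT h). Qed.

Lemma rot2_neq d : r (r d) <> d.
Proof. by move=> h; have := @iter_porbit_inj _ r d 2 0; rewrite card_rot => /(_ isT isT h). Qed.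

Lemma same_src d d' : src d' = src d -> [\/ d' = d, d' = r d | d' = r (r d)].
Proof.
move/eqP; rewrite -rotationP => /porbit_iterP [i]; rewrite card_rot.
by case: i => [|[|[|//]]] _ ->; [apply: Or31 | apply: Or32 | apply: Or33].
Qed.

Lemma src_face d : src (phi d) = tgt d.
Proof. by rewrite face_permE src_rot. Qed.

Lemma face_rot2 d : phi (e (r (r d))) = d.
Proof. by rewrite face_permE revK rot3. Qed.

Lemma card_darts : #|{: dt}| = 3 * #|G|.
Proof.
rewrite -sum1_card (partition_big (@src G) xpredT) //=.
rewrite mulnC -sum_nat_const; apply: eq_bigr => v _.
by rewrite -[RHS](card_out v) -sum1_card; apply: eq_bigl => d; rewrite inE.
Qed.

Lemma card_edges : #|edges G| * 2 = 3 * #|G|.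
Proof.
rewrite -card_darts -[in RHS]sum1_card.
rewrite (partition_big (@dart_edge G) (mem (edges G))) /=; last first.
  by move=> d _; apply/edgesP; exists d.
rewrite -sum_nat_const; apply: eq_bigr => E /edgesP [d ->].
transitivity #|[set d; e d]|.
  by rewrite cards2; case: eqP => // /esym /rev_neq.
rewrite -sum1_card; apply: eq_bigl => d'; rewrite !inE; apply/idP/eqP.
  by case/orP=> /eqP -> //; rewrite dart_edge_rev.
by case/dart_edge_eq=> ->; rewrite eqxx ?orbT.
Qed.

Section PentHex.
Hypothesis facesE : faces G == pentagons G :|: hexagons G.

Lemma face_size d : #|porbit phi d| = 5 \/ #|porbit phi d| = 6.
Proof.
have : porbit phi d \in faces G by apply: imset_f.
by rewrite (eqP facesE) !inE => /orP [] /andP [_ /eqP ->]; [left | right].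
Qed.

Lemma face_nobacktrack d : tgt (phi d) <> src d.
Proof.
move=> h; apply: (@rot_neq (e d)); rewrite -face_permE; apply: dart_inj => //.
by rewrite src_face.
Qed.

Lemma face_rev_far d j : j < 4 -> iter j phi d <> e d.
Proof.
case: j => [|[|[|[|//]]]] _ /= h.
- exact: (@rev_neq _ d).
- by apply: (@rot_neq (e d)); rewrite -face_permE.
- have := src_neq_tgt (phi d).
  by rewrite src_face -(src_face (phi d)) h src_rev eqxx.
- by apply: (@face_nobacktrack (phi d)); rewrite -src_face h src_rev src_face.
Qed.

(** If [e d] came [j] steps after [d] on a face of length at most 6, then [j] or the length minus
    [j] would be below 4, and [face_rev_far] excludes both. *)
Lemma face_rev d : porbit phi (e d) != porbit phi d.
Proof.
rewrite -mem_porbit_eq; apply/negP=> /porbit_iterP [j jlt h].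
have [j4|j4] := ltnP j 4; first exact: (@face_rev_far d j).
apply: (@face_rev_far (e d) (#|porbit phi d| - j)).
  by case: (face_size d) jlt => ->; lia.
by rewrite h -iterD subnK 1?ltnW // iter_porbit -[LHS]revK h.
Qed.

(** A second dart from the same vertex on the same face would be [r d] or [r (r d)], and the face
    would then run along both sides of one edge. *)
Lemma face_src_inj d d' : porbit phi d' = porbit phi d -> src d' = src d -> d' = d.
Proof.
move=> o /same_src [//||] h; subst d'.
- have := face_rev d; rewrite -o.
  by rewrite -(porbit_step phi (e d)) face_permE revK eqxx.
- have := face_rev (r (r d)).
  by rewrite -(porbit_step phi (e _)) face_rot2 o eqxx.
Qed.

Lemma card_faces : #|faces G| = #|pentagons G| + #|hexagons G|.
Proof.
rewrite {1}(eqP facesE) cardsU (_ : _ :&: _ = set0) ?cards0 ?subn0 //.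
apply/setP=> f; rewrite !inE; case: (f \in _) => //=.
by apply/negP=> /andP [/eqP ->].
Qed.

Lemma card_pent_hex : #|pentagons G| * 5 + #|hexagons G| * 6 = 3 * #|G|.
Proof.
rewrite -card_darts !card_porbits_size -cardsUI (_ : _ :&: _ = set0).
  rewrite cards0 addn0 -cardsT; apply: eq_card => d; rewrite !inE.
  by case: (face_size d) => ->.
by apply/setP=> d; rewrite !inE; apply/negP=> /andP [/eqP ->].
Qed.

Lemma card_pentagons : plane G -> #|pentagons G| = 12.
Proof.
case/andP=> _ /eqP; rewrite card_faces => euler.
have c := card_pent_hex; have ce := card_edges; lia.
Qed.

End PentHex.
End Cubic.

(** * Vertex-disjoint faces *)

(* [C] marks the darts along the boundaries of a family of faces, [mt] the darts of a
   perfect matching of the vertices on none of these faces. *)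
Section Cover.
Variable G : embedded_graph.

Local Notation dt := (dart G).
Local Notation r := (rotation G).
Local Notation e := (@rev_dart G).
Local Notation phi := (face_perm G).

Variables C mt : pred dt.
Definition covered (v : G) := [exists d, C d && (src d == v)].

Record face_cover : Prop := FaceCover {
  cover_face : forall d, C (phi d) = C d;
  cover_src : forall d d', C d -> C d' -> src d' = src d -> d' = d;
  match_src : forall d d', mt d -> mt d' -> src d' = src d -> d' = d;
  match_rev : forall d, mt d -> mt (e d);
  match_covered : forall d, mt d -> ~~ covered (src d);
  match_ex : forall v, ~~ covered v -> exists2 d, mt d & src d = v }.

(** [C (r d)] is the condition [C (e d)] in disguise, because [phi (e d) = r d]: neither side of a
    link may belong to the family. *)
Definition link_dart d := ~~ [|| C d, C (r d) | mt d].
Local Notation K := link_dart.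

(* The next link around the contracted face or matching edge at [src d]. *)
Definition next_link d := if K (r d) then r d else phi (r d).
Local Notation sigma := next_link.

(* The corner of an exit lies between two links; [d] is the second one. *)
Definition exit_dart d := K d && K (r (r d)).
Local Notation X := exit_dart.

Lemma cover_covered d : C d -> covered (src d).
Proof. by move=> cd; apply/existsP; exists d; rewrite cd eqxx. Qed.

(** Injectivity is a separate hypothesis because [pent_covered] applies this count before a
    [face_cover] is available. *)
Lemma card_covered : (forall d d', C d -> C d' -> src d' = src d -> d' = d) ->
  #|[set v | covered v]| = #|[set d | C d]|.
Proof.
move=> C_src; rewrite -(card_in_imset (f := @src G) (D := [set d | C d])); last first.
  by move=> d d'; rewrite !inE => cd cd' /esym s; rewrite (C_src d d').
apply: eq_card => v; rewrite inE; apply/existsP/imsetP.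
  by case=> d /andP [cd /eqP <-]; exists d; rewrite ?inE.
by case=> d; rewrite inE => cd ->; exists d; rewrite cd eqxx.
Qed.

Hypothesis cubicG : cubic G.
Hypothesis coverG : face_cover.
Local Notation C_face := (cover_face coverG).
Local Notation C_src := (cover_src coverG).
Local Notation mt_src := (match_src coverG).
Local Notation mt_rev := (match_rev coverG).
Local Notation mt_covered := (match_covered coverG).
Local Notation mt_ex := (match_ex coverG).

Lemma cover_rev d : C (e d) = C (r d).
Proof. by rewrite -C_face face_permE revK. Qed.

Lemma match_revE d : mt (e d) = mt d.
Proof. by apply/idP/idP=> /mt_rev //; rewrite revK. Qed.

Lemma link_rev d : K (e d) = K d.
Proof.
by rewrite /K cover_rev -face_permE C_face match_revE !orbA (orbC (C d)).
Qed.

Lemma match_not_cover d d' : mt d -> src d' = src d -> C d' = false.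
Proof.
by move=> md s; apply/negP=> /cover_covered; rewrite s; apply/negP/mt_covered.
Qed.

Lemma cover_rot h : C h -> C (r h) = false.
Proof.
move=> ch; apply/negP=> cr.
by apply: (rot_neq cubicG (d := h)); apply: C_src => //; rewrite src_rot.
Qed.

Lemma cover_rot2 h : C h -> C (r (r h)) = false.
Proof.
move=> ch; apply/negP=> cr.
by apply: (rot2_neq cubicG (d := h)); apply: C_src => //; rewrite !src_rot.
Qed.

Lemma cover_not_match d d' : C d -> src d' = src d -> mt d' = false.
Proof.
move=> cd s; apply/negP=> /mt_covered; rewrite s => /negP; apply; exact: cover_covered.
Qed.

(** At a vertex of the family, [h] continues the boundary, [r (r h)] is the reverse of the boundary
    dart that arrives, and [r h] leaves the face. *)
Lemma link_cover h : C h -> [/\ K h = false, K (r h) & K (r (r h)) = false].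
Proof.
move=> ch; split; rewrite /K ?rot3 // ?ch ?orbT //.
by rewrite cover_rot // cover_rot2 // (cover_not_match ch) // src_rot.
Qed.

Lemma link_match a : mt a -> [/\ K a = false, K (r a) & K (r (r a))].
Proof.
move=> ma; split; rewrite /K ?ma ?orbT //.
  rewrite !(match_not_cover ma) ?src_rot //=; apply/negP=> mr.
  by apply: (rot_neq cubicG (d := a)); apply: mt_src => //; rewrite src_rot.
rewrite !(match_not_cover ma) ?src_rot //=; apply/negP=> mr.
by apply: (rot2_neq cubicG (d := a)); apply: mt_src => //; rewrite !src_rot.
Qed.

Lemma link_cases d : K d ->
  (exists2 h, C h & d = r h) \/ exists2 a, mt a & d = r a \/ d = r (r a).
Proof.
move=> kd; have [/existsP [h /andP [ch /eqP sh]]|nc] := boolP (covered (src d)).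
  left; exists h => //; have [k1 k2 k3] := link_cover ch.
  by have [//|e1|//|e1] := same_src cubicG (d := h) (d' := d); rewrite e1 ?k1 ?k3 in kd *.
right; have [a ma sa] := mt_ex nc; exists a => //; have [k1 k2 k3] := link_match ma.
have [//|e1|->|->] := same_src cubicG (d := a) (d' := d); [|by left|by right].
by rewrite e1 k1 in kd.
Qed.

Lemma link_after_rest d : ~~ C d -> ~~ K d -> K (phi d).
Proof.
move=> nc; rewrite negbK (negbTE nc) /= face_permE => /orP [].
  by rewrite -cover_rev => /link_cover [].
by rewrite -match_revE => /link_match [].
Qed.

Lemma link_not_cover d : K d -> ~~ C d.
Proof. by rewrite /K => /norP []. Qed.

Lemma exit_rot d : X (r d) = K (r d) && K d.
Proof. by rewrite /X rot3. Qed.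

Lemma exit_face d : X (phi d) = K (phi d) && K d.
Proof. by rewrite face_permE exit_rot link_rev. Qed.

Lemma exit_covered q : X q -> ~~ covered (src q).
Proof.
move=> /andP [kq]; have [[h ch ->]|[a ma [->|->] _]] := link_cases kq.
- by rewrite rot3 //; have [->] := link_cover ch.
- by rewrite src_rot; apply: mt_covered.
- by rewrite !src_rot; apply: mt_covered.
Qed.

Lemma exit_match a : mt a -> X (r a) = false /\ X (r (r a)).
Proof.
by move=> ma; have [k1 k2 k3] := link_match ma; rewrite !exit_rot k1 k2 k3.
Qed.

Lemma exit_src q q' : X q -> X q' -> src q = src q' -> q = q'.
Proof.
suff ex d : X d -> exists2 a, mt a & d = r (r a).
  move=> /ex [a ma ->] /ex [b mb ->]; rewrite !src_rot => s.
  by congr (r (r _)); apply: mt_src.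
move=> xd; case: (andP xd) => kd _.
have [[h ch ed]|[a ma [ed|->]]] := link_cases kd; last by exists a.
  by have := exit_covered xd; rewrite ed src_rot cover_covered.
by case: (exit_match ma); rewrite -ed xd.
Qed.

(** Serves twice: every vertex off the family carries exactly one exit and exactly one dart of the
    matching. *)
Lemma card_uncovered (P : pred dt) : (forall d, P d -> ~~ covered (src d)) ->
  (forall d d', P d -> P d' -> src d = src d' -> d = d') ->
  (forall v, ~~ covered v -> exists2 d, P d & src d = v) ->
  #|[set d | P d]| + #|[set d | C d]| = #|G|.
Proof.
move=> Pc Pi Pe; rewrite -(card_covered C_src) -(cardsC [set v | covered v]) addnC.
congr (_ + _); rewrite -(card_in_imset (f := @src G) (D := [set d | P d])); last first.
  by move=> d d'; rewrite !inE; apply: Pi.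
apply: eq_card => v; rewrite !inE; apply/imsetP/idP.
  by case=> d; rewrite inE => /Pc pd ->.
by case/Pe=> d pd <-; exists d; rewrite ?inE.
Qed.

Lemma card_exit : #|[set d | X d]| + #|[set d | C d]| = #|G|.
Proof.
apply: card_uncovered => [d|d d'|v]; [exact: exit_covered|exact: exit_src|].
case/mt_ex=> a ma <-; exists (r (r a)); last by rewrite !src_rot.
by case: (exit_match ma).
Qed.

Lemma card_mt : #|[set d | mt d]| + #|[set d | C d]| = #|G|.
Proof.
apply: card_uncovered => [d|d d' md md' s|v]; [exact: mt_covered| |exact: mt_ex].
exact: mt_src.
Qed.

(* On a face outside the family no two consecutive darts miss [K], so except at the
   exits the boundary alternates between [K] and its complement. *)
Lemma odd_face_exit d : ~~ C d -> odd #|porbit phi d| ->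
  exists2 q, q \in porbit phi d & X q.
Proof.
move=> nc od; case: (pickP [pred q in porbit phi d | X q]) => [q /andP []|none].
  by exists q.
have CO x : x \in porbit phi d -> ~~ C x.
  case/porbit_iterP=> i _ ->; elim: i => //= i; by rewrite C_face.
have PO x : (phi x \in porbit phi d) = (x \in porbit phi d).
  by rewrite !mem_porbit_eq porbit_step.
(* Without exits, [phi] maps the non-links in [N] bijectively onto the links of the face, so the
   length of the face is even. *)
pose N := [set x in porbit phi d | ~~ K x].
have oE : #|porbit phi d| = #|N| + #|N|; last by rewrite oE addnn odd_double in od.
rewrite -(cardsID [set x | K x] (porbit phi d)) addnC; congr (_ + _).
  by apply: eq_card => x; rewrite !inE andbC.
rewrite -(card_imset N (@perm_inj _ phi)); apply: eq_card => x.
rewrite !inE; apply/andP/imsetP => [[xO kx]|[y]].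
  exists (e (r (r x))); last by rewrite face_rot2.
  rewrite inE -PO face_rot2 // xO link_rev; have := none x.
  by rewrite /= xO /= /X kx /= => ->.
by rewrite inE => /andP [yO ky] ->; rewrite PO yO link_after_rest ?CO.
Qed.

(** * Rotation of the links around contracted faces and edges *)

Lemma link_next d : K d -> K (sigma d).
Proof.
move=> kd; rewrite /sigma; case: ifP => // nk.
have [[h ch dh]|[a ma [dh|dh]]] := link_cases kd; subst d.
- apply: link_after_rest; last by rewrite nk.
  by rewrite cover_rot2.
- by have [_ _ k] := link_match ma; rewrite k in nk.
- by rewrite rot3 // face_permE; have [] := link_match (mt_rev ma).
Qed.

(** [e (r (r h))] is the dart before [h] on its face: around a contracted face [sigma] runs against
    [phi]. *)
Lemma next_link_cover h : C h -> sigma (r h) = r (e (r (r h))) /\ C (e (r (r h))).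
Proof.
move=> ch; rewrite /sigma; have [_ _ ->] := link_cover ch.
by rewrite face_permE cover_rev rot3.
Qed.

Lemma next_link_match a : mt a -> sigma (r a) = r (r a) /\ sigma (r (r a)) = r (e a).
Proof.
move=> ma; have [k1 k2 k3] := link_match ma.
by rewrite /sigma k3 rot3 // k1 face_permE.
Qed.

Variable c : nat.
Hypothesis C_size : forall d, C d -> #|porbit phi d| = c.

Definition link_size d := if covered (src d) then c else 4.
Local Notation sz := link_size.

Lemma link_size_cover h : C h -> sz (r h) = c.
Proof. by move=> ch; rewrite /sz src_rot cover_covered. Qed.

Lemma link_size_match a : mt a -> sz (r a) = 4 /\ sz (r (r a)) = 4.
Proof. by move=> ma; rewrite /sz !src_rot (negbTE (mt_covered ma)). Qed.

Lemma link_size_gt0 d : K d -> 0 < sz d.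
Proof.
move=> kd; have [[h ch ->]|[a ma [->|->]]] := link_cases kd.
- by rewrite link_size_cover // -(C_size ch) lt0n card_porbit_neq0.
- by have [->] := link_size_match ma.
- by have [_ ->] := link_size_match ma.
Qed.

Lemma link_size_next d : K d -> sz (sigma d) = sz d.
Proof.
move=> kd; have [[h ch ->]|[a ma [->|->]]] := link_cases kd.
- by have [-> ch'] := next_link_cover ch; rewrite !link_size_cover.
- by have [-> _] := next_link_match ma; have [-> ->] := link_size_match ma.
- have [_ ->] := next_link_match ma; have [_ ->] := link_size_match ma.
  by have [->] := link_size_match (mt_rev ma).
Qed.

Lemma exit_next d : K d -> X (sigma d) = ~~ covered (src d) && ~~ X d.
Proof.
move=> kd; have [[h ch ->]|[a ma [->|->]]] := link_cases kd.
- have [-> ch'] := next_link_cover ch; rewrite src_rot cover_covered //=.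
  by apply/negP=> /exit_covered; rewrite src_rot cover_covered.
- have [-> _] := next_link_match ma; have [-> ->] := exit_match ma.
  by rewrite src_rot mt_covered.
- have [_ ->] := next_link_match ma; have [_ ->] := exit_match ma.
  by rewrite andbF; have [->] := exit_match (mt_rev ma).
Qed.

Lemma next_period d : K d ->
  iter (sz d) sigma d = d /\ forall j, 0 < j < sz d -> iter j sigma d <> d.
Proof.
move=> kd; have [[h ch ->]|[a ma dE]] := link_cases kd.
  (* [h'] is the dart that lies [j] steps before [h] on the boundary. *)
  have it j : exists h', [/\ C h', iter j phi h' = h & iter j sigma (r h) = r h'].
    elim: j => [|j [h' [ch' <- /= ->]]]; first by exists h.
    have [-> ch2] := next_link_cover ch'; exists (e (r (r h'))); split=> //.
    by rewrite -iterS iterSr face_rot2.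
  rewrite link_size_cover //; split=> [|j /andP [j0 jc]].
    have [h' [ch' hh' ->]] := it c; congr (r _).
    by rewrite -hh' -(C_size ch') iter_porbit.
  have [h' [ch' hh' ->]] := it j => /perm_inj eh; subst h'.
  have := @iter_porbit_inj _ phi h j 0; rewrite (C_size ch).
  by move=> /(_ jc (ltn_trans j0 jc) hh') E; rewrite E in j0.
have [n1 n2] := next_link_match ma; have [n3 n4] := next_link_match (mt_rev ma).
rewrite revK in n4; have [s1 s2] := link_size_match ma.
have srcN : src (e a) <> src a.
  by move=> s; have := src_neq_tgt a; rewrite -src_rev s eqxx.
case: dE => ->; rewrite ?s1 ?s2; split=> [|[|[|[|[|//]]]] //=]; rewrite /= ?(n1, n2, n3, n4) //.
- by move=> _; apply: rot_neq.
- by move=> _ /perm_inj E; rewrite E in srcN.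
- by move=> _ /(congr1 (@src G)); rewrite !src_rot.
- by move=> _ /(congr1 (@src G)); rewrite !src_rot.
- by move=> _ /(congr1 (@src G)); rewrite !src_rot.
- by move=> _ /perm_inj /esym; apply: rot_neq.
Qed.

Lemma card_link_covered : #|[set d | K d && covered (src d)]| = #|[set d | C d]|.
Proof.
rewrite -(card_imset [set d | C d] (@perm_inj _ r)); apply: eq_card => d.
rewrite inE; apply/andP/imsetP => [[kd cd]|[h]].
  have [[h ch ->]|[a ma dE]] := link_cases kd; first by exists h; rewrite ?inE.
  by case/negP: (mt_covered ma); case: dE cd => ->; rewrite !src_rot.
by rewrite inE => ch ->; rewrite src_rot cover_covered //; case: (link_cover ch).
Qed.

Lemma card_link_uncovered :
  #|[set d | K d && ~~ covered (src d)]| = 2 * #|[set d | mt d]|.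
Proof.
rewrite mul2n -addnn -{1}(card_imset [set d | mt d] (@perm_inj _ r)).
rewrite -(card_imset [set d | mt d] (inj_comp (@perm_inj _ r) (@perm_inj _ r))).
rewrite -cardsUI addnC (_ : _ :&: _ = set0) ?cards0.
  apply: eq_card => d; rewrite !inE; apply/andP/orP => [[kd nc]|].
    have [[h ch ed]|[a ma [->|->]]] := link_cases kd.
    - by rewrite ed src_rot cover_covered in nc.
    - by left; apply/imsetP; exists a; rewrite ?inE.
    - by right; apply/imsetP; exists a; rewrite ?inE.
  by case=> /imsetP [a]; rewrite inE => ma ->; have [k1 k2 k3] := link_match ma;
    rewrite /= !src_rot mt_covered.
apply/setP=> d; rewrite !inE; apply/negP=> /andP [/imsetP [a] + ->].
rewrite inE => ma /imsetP [b]; rewrite inE => mb /= E.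
have := exit_match ma; have := exit_match mb; rewrite E => -[_ ->] [].
by [].
Qed.

Lemma card_link : #|[set d | K d]| = #|[set d | C d]| + 2 * #|[set d | mt d]|.
Proof.
rewrite -card_link_covered -card_link_uncovered.
rewrite -(cardsID [set d | covered (src d)]); congr (_ + _);
  by apply: eq_card => d; rewrite !inE // andbC.
Qed.

Lemma iter_next_K d j : K d -> K (iter j sigma d).
Proof. by move=> kd; elim: j => //= j; apply: link_next. Qed.

Lemma src_exit d : K d -> X (sigma d) -> src (sigma d) = src d.
Proof.
move=> kd; have [[h ch ->]|[a ma [->|->]]] := link_cases kd.
- have [-> ch'] := next_link_cover ch => /exit_covered; by rewrite src_rot cover_covered.
- by have [-> _] := next_link_match ma; rewrite !src_rot.
- by have [_ ->] := next_link_match ma; have [->] := exit_match (mt_rev ma).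
Qed.

Lemma link_ex v : exists2 d, K d & src d = v.
Proof.
have [/existsP [h /andP [ch /eqP sh]]|nc] := boolP (covered v).
  by exists (r h); [case: (link_cover ch) | rewrite src_rot].
have [a ma sa] := mt_ex nc.
by exists (r a); [case: (link_match ma) | rewrite src_rot].
Qed.

Lemma link_src d d' : K d -> K d' -> src d' = src d ->
  [\/ d' = d, d' = sigma d /\ X (sigma d) | d = sigma d' /\ X (sigma d')].
Proof.
move=> kd kd' s; have [||dE|dE] := same_src cubicG (d := d) (d' := d') => //.
- exact: Or31.
- by apply: Or32; rewrite /sigma -dE kd' dE exit_rot kd -dE kd'.
- apply: Or33; have rd : r d' = d by rewrite dE rot3.
  by rewrite /sigma rd kd -rd exit_rot rd kd kd'.
Qed.

(** This recovers adjacency in [G] from the contracted map: an edge is either a link or a step of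
    [sigma] from one vertex to another. *)
Lemma edge_link d : [\/ K d, exists k, [/\ K k, src k = src d & src (sigma k) = tgt d]
  | exists k, [/\ K k, src k = tgt d & src (sigma k) = src d]].
Proof.
have step x : K (r (r x)) -> K x = false ->
    src (r (r x)) = src x /\ src (sigma (r (r x))) = tgt x.
  by move=> k nk; rewrite !src_rot /sigma rot3 // nk src_face.
case kd : (K d); first exact: Or31.
move/negbT: (kd); rewrite negbK => /or3P [cd|cd|md].
- apply: Or33; exists (r (r (e d))); have ce : C (r (e d)) by rewrite -face_permE C_face.
  have kr : K (r (r (e d))) by case: (link_cover ce).
  by have [] := step (e d) kr; rewrite ?link_rev // => -> ->.
- apply: Or32; exists (r (r d)); have kr : K (r (r d)) by case: (link_cover cd).
  by have [] := step d kr kd => -> ->.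
- apply: Or32; exists (r (r d)); have kr : K (r (r d)) by case: (link_match md).
  by have [] := step d kr kd => -> ->.
Qed.

Lemma link_connected (P : pred dt) : connected G ->
  (forall d, K d -> P d -> P (e d) /\ P (sigma d)) ->
  (exists2 d, K d & P d) -> forall d, K d -> P d.
Proof.
move=> /forallP conG step [d0 k0 p0] d kd.
(* [sigma] is periodic, so a set stable under [sigma] is also stable under its inverse. *)
have back x : K x -> P (sigma x) -> P x.
  move=> kx px; have [it _] := next_period kx.
  have itP j : P (iter j.+1 sigma x).
    by elim: j => //= j IH; exact: (step _ (iter_next_K j.+1 kx) IH).2.
  by rewrite -it -(prednK (link_size_gt0 kx)).
pose Q v := forall x, K x -> src x = v -> P x.
have Q1 x : K x -> P x -> Q (src x).
  move=> kx px y ky s; have [->//|[-> _]|[xy _]] := link_src kx ky s.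
    by have [] := step x kx px.
  by apply: back => //; rewrite -xy.
have Qadj v w : adj v w -> Q v -> Q w.
  move=> a qv; pose x := exist _ (v, w) a : dt.
  have [kx|[k [kk s1 s2]]|[k [kk s1 s2]]] := edge_link x.
  - by have [pe _] := step x kx (qv x kx erefl); apply: (Q1 (e x)) => //; rewrite link_rev.
  - rewrite -[w]/(tgt x) -s2; apply: Q1; first exact: link_next.
    exact: (step k kk (qv k kk s1)).2.
  - rewrite -[w]/(tgt x) -s1; apply: Q1 => //; apply: back => //.
    by apply: qv s2; apply: link_next.
have := forallP (conG (src d0)) (src d); rewrite !inE /= => /connectP [p].
elim: p (src d0) (Q1 d0 k0 p0) => [|w p IH] v qv /=; first by move=> _ s; apply: qv.
by rewrite !inE /= andbT => /andP [a pp] l; apply: (IH w) => //; apply: Qadj qv.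
Qed.

(** * Faces outside the family as triangles of the contracted map *)

Section Triangles.
Hypothesis exit_uniq : forall q q', X q -> X q' ->
  porbit phi q = porbit phi q' -> q = q'.
Hypothesis link_face : forall d, K d -> #|porbit phi d| = 5 \/
  #|porbit phi d| = 6 /\ forall q, q \in porbit phi d -> ~~ X q.

Local Notation tau d := (sigma (e d)).

Lemma triangleE d : tau d = if K (phi d) then phi d else phi (phi d).
Proof. by rewrite /sigma -face_permE. Qed.

Lemma triangle_face d : porbit phi (tau d) = porbit phi d.
Proof. by rewrite triangleE; case: ifP; rewrite !porbit_step. Qed.

Lemma triangle_neq d : K d -> tau d <> d.
Proof.
move=> kd; rewrite triangleE; case: ifP => _ h.
- have := @iter_porbit_inj _ phi d 1 0.
  by case: (link_face kd) => [->|[-> _]] /(_ isT isT h).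
- have := @iter_porbit_inj _ phi d 2 0.
  by case: (link_face kd) => [->|[-> _]] /(_ isT isT h).
Qed.

Lemma triangle_exit d : K d -> X d -> ~~ X (tau d).
Proof.
move=> kd xd; apply/negP=> xt; apply: (triangle_neq kd).
by apply: exit_uniq => //; rewrite triangle_face.
Qed.

(** [tau] visits the links of a face in turn, and there are three of them. Two consecutive non-links
    are excluded by [alt], two consecutive links occur only at an exit; a pentagon with at most one
    exit therefore has three links and two other darts, a hexagon without exits has three of each.
    The proof runs through all patterns of [K] along the boundary. *)
Lemma triangle3 d : K d -> tau (tau (tau d)) = d.
Proof.
move=> kd; have nc i : ~~ C (iter i phi d).
  by elim: i => [|i] /=; rewrite ?C_face //; apply: link_not_cover.
have alt i : K (iter i phi d) || K (iter i.+1 phi d).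
  by case ki : (K _) => //=; apply: link_after_rest; rewrite ?nc ?ki.
have exE i : X (iter i.+1 phi d) = K (iter i.+1 phi d) && K (iter i phi d).
  exact: exit_face.
rewrite !triangleE; have [c5|[c6 nx]] := link_face kd.
  have p5 : iter 5 phi d = d by rewrite -c5 iter_porbit.
  have once i j : i < j -> j < 5 -> ~~ (X (iter i.+1 phi d) && X (iter j.+1 phi d)).
    move=> ij j5; apply/negP=> /andP [xi xj].
    have E : i = j.
      apply: (@iter_porbit_inj _ phi d); rewrite ?c5 ?(ltn_trans ij) //.
      by apply: (@perm_inj _ phi); apply: exit_uniq => //; rewrite -!iterS !porbit_iter.
    by rewrite E ltnn in ij.
  move: (alt 1) (alt 2) (alt 3) (once 0 1 isT isT) (once 0 2 isT isT)
    (once 0 3 isT isT) (once 0 4 isT isT) (once 1 2 isT isT) (once 1 3 isT isT)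
    (once 1 4 isT isT) (once 2 3 isT isT) (once 2 4 isT isT) (once 3 4 isT isT).
  rewrite !exE p5 kd; rewrite /= in p5 *.
  by case k1: (K (phi d)); case k2: (K (phi (phi d)));
    case k3: (K (phi (phi (phi d)))); case k4: (K (phi (phi (phi (phi d)))));
    rewrite //= ?(k1, k2, k3, k4, p5, kd) //= ?(k1, k2, k3, k4, p5, kd).
have p6 : iter 6 phi d = d by rewrite -c6 iter_porbit.
have none i : ~~ X (iter i.+1 phi d) by apply: nx; rewrite mem_porbit_eq porbit_iter.
move: (alt 1) (alt 2) (alt 3) (alt 4) (none 0) (none 1) (none 2) (none 3) (none 4) (none 5).
rewrite !exE p6 kd; rewrite /= in p6 *.
by case k1: (K (phi d)); case k2: (K (phi (phi d)));
  case k3: (K (phi (phi (phi d)))); case k4: (K (phi (phi (phi (phi d)))));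
  case k5: (K (phi (phi (phi (phi (phi d))))));
  rewrite //= ?(k1, k2, k3, k4, k5, p6, kd) //= ?(k1, k2, k3, k4, k5, p6, kd).
Qed.
End Triangles.
End Cover.

(** * Gluing tables *)

(* A point [(a, j)] is the [j]-th half-link of piece number [a]. A piece [(s, b)] has
   [s] half-links in rotation order; for [s = 4] it is an edge, whose exits lie at
   the positions of one parity, and [b] tells whether position 0 is an exit. *)
Definition point := (nat * nat)%type.

Record table := Table {
  pieces : seq (nat * bool);
  gluing : seq (seq (option point));
  open_points : seq point }.

Definition eqpt (p q : point) := eqn p.1 q.1 && eqn p.2 q.2.

Section Tables.
Variable T : table.

Definition piece (p : point) := nth (0, false) (pieces T) p.1.
Definition valid (p : point) := p.2 < (piece p).1.
Definition points : seq point :=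
  [seq (a, j) | a <- iota 0 (size (pieces T)), j <- iota 0 (piece (a, 0)).1].
Definition after (p : point) : point :=
  (p.1, if eqn p.2.+1 (piece p).1 then 0 else p.2.+1).
Definition before (p : point) : point :=
  (p.1, if p.2 is j.+1 then j else (piece p).1.-1).
Definition exit (p : point) := eqn (piece p).1 4 && ((piece p).2 (+) odd p.2).
Definition partner (p : point) := nth None (nth [::] (gluing T) p.1) p.2.
Definition turn (p : point) := omap after (partner p).

(** A necessary condition on partial gluings: the triangle is followed only as far as it is glued,
    and only a contradiction makes the test fail. *)
Definition triangle_ok (p : point) :=
  if turn p is Some p1 then
    [&& ~~ eqpt p1 p, ~~ (exit p && exit p1) &
     if turn p1 is Some p2 then
       ~~ (exit p2 && (exit p || exit p1)) &&
       (if turn p2 is Some p3 then eqpt p3 p else true)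
     else true]
  else true.

(** In a symmetric gluing [partner (before p)] is the half-link that [turn] sends to [p]. Two steps
    back reach the beginning of an open chain inside a triangle. *)
Fixpoint chain_start n (p : point) :=
  if n is n'.+1 then
    if partner (before p) is Some q then chain_start n' q else p
  else p.

Definition local_ok p := triangle_ok (chain_start 2 p).

(** Here [p] is the third half-link of its triangle, whose closing determines the partner of [p]. *)
Definition forced (p : point) :=
  if partner (before p) is Some q then isSome (partner (before q)) else false.

(** Forced half-links come before others, and otherwise the piece with the fewest open half-links is
    preferred. This only affects the size of the search tree: [search_realizes] holds for any
    choice. *)
Definition choose : option point :=
  if [seq p <- open_points T | forced p] is p :: _ then Some p else
  omap snd (foldl (fun best p =>
    let n := count (fun q => eqn q.1 p.1) (open_points T) in
    if best is Some (k, _) then if n < k then Some (n, p) else best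
    else Some (n, p)) None (open_points T)).

End Tables.

Definition put (g : seq (seq (option point))) (p : point) x :=
  set_nth [::] g p.1 (set_nth None (nth [::] g p.1) p.2 x).

Definition glue T (p q : point) :=
  Table (pieces T) (put (put (gluing T) p (Some q)) q (Some p))
    [seq x <- open_points T | if eqpt x p then false else ~~ eqpt x q].

Definition add_piece T t := Table (rcons (pieces T) t) (gluing T)
  (open_points T ++ [seq (size (pieces T), j) | j <- iota 0 t.1]).

Definition root t := add_piece (Table [::] [::] [::]) t.

Definition checked p (q : point) T := if local_ok T p then local_ok T q else false.

Section Search.
Variables (types : seq (nat * bool)) (lim : nat -> nat).

(** A new piece may be numbered from the half-link that is glued, so position 0 is enough; for an
    edge the two types tell whether that half-link is an exit. *)
Definition extend T (p : point) t := glue (add_piece T t) p (size (pieces T), 0).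

Definition may_extend T (t : nat * bool) := count (fun u => eqn u.1 t.1) (pieces T) < lim t.1.

(* When [choose] fails or the fuel runs out, the table itself is returned, so that
   no gluing is ever lost. *)
Fixpoint search fuel T : seq table :=
  if fuel is n.+1 then
    if choose T is Some p then
      if valid T p && ~~ isSome (partner T p) then
        flatten [seq let T' := glue T p q in
                     if checked p q T' then search n T' else [::]
                | q <- open_points T & ~~ eqpt q p] ++
        flatten [seq let T' := extend T p t in
                     if checked p (size (pieces T), 0) T' then search n T' else [::]
                | t <- types & may_extend T t]
      else [:: T]
    else [:: T]
  else [:: T].

End Search.

Lemma all_flatten A (P : pred A) ss : all P (flatten ss) = all (all P) ss.
Proof. by elim: ss => //= s ss <-; rewrite all_cat. Qed.

Lemma eqptE p q : eqpt p q = (p == q).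
Proof. by case: p q => [a i] [b j]. Qed.

Lemma mem_points T p : (p \in points T) = valid T p.
Proof.
case: p => a j; rewrite /valid; apply/allpairsPdep/idP => /= [[b [i [bT ip [-> ->]]]]|v].
  by move: ip; rewrite mem_iota.
exists a, j; split=> //; rewrite mem_iota //= add0n.
by rewrite /piece /= in v; case: ltnP => // h; rewrite nth_default in v.
Qed.

Lemma points_uniq T : uniq (points T).
Proof.
apply: allpairs_uniq_dep; first exact: iota_uniq; first by move=> *; apply: iota_uniq.
by move=> [a i] [b j] _ _ /= [-> ->].
Qed.

Lemma partner_put P g p x o q :
  partner (Table P (put g p x) o) q = if q == p then x else partner (Table P g o) q.
Proof.
case: p q => [a i] [b j]; rewrite /partner /put /= nth_set_nth /= xpair_eqE.
by case: eqP => [->|] //=; rewrite nth_set_nth.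
Qed.

Lemma partner_glue T p q x : partner (glue T p q) x =
  if x == q then Some p else if x == p then Some q else partner T x.
Proof. by rewrite /glue !partner_put. Qed.

Lemma valid_after T p : valid T p -> valid T (after T p).
Proof.
by rewrite /valid /after /= /piece /= eqnE; case: eqP => h; [case: p.2 h => [|j] <- //|lia].
Qed.

Lemma count_points T s : size [seq p <- points T | eqn (piece T p).1 s] =
  s * count (fun u => eqn u.1 s) (pieces T).
Proof.
rewrite /points /piece /=; set P := pieces T.
rewrite size_filter count_flatten -map_comp.
have -> : [seq count (fun p : point => eqn (nth (0, false) P p.1).1 s)
      [seq (a, j) | j <- iota 0 (nth (0, false) P a).1] | a <- iota 0 (size P)] =
    [seq s * eqn (nth (0, false) P a).1 s | a <- iota 0 (size P)].
  apply: eq_map => a; rewrite count_map (@eq_count _ _ (fun=> eqn (nth (0, false) P a).1 s)) //.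
  rewrite eqnE; case: eqP => [->|_] /=; last by rewrite count_pred0 muln0.
  by rewrite count_predT size_iota muln1.
have -> : [seq s * eqn (nth (0, false) P a).1 s | a <- iota 0 (size P)] =
    [seq s * eqn u.1 s | u <- P].
  by rewrite -[in RHS](mkseq_nth (0, false) P) -map_comp.
by elim: P => [|u P IH] /=; rewrite ?muln0 // IH mulnDr.
Qed.

(** * Completeness of the search for an abstract map of links *)

Section Realization.
Variables (D : finType) (e sigma : D -> D) (K X : pred D) (sz : D -> nat).
Hypothesis eK : involutive e.
Hypothesis K_e : forall d, K d -> K (e d).
Hypothesis e_neq : forall d, e d <> d.
Hypothesis K_s : forall d, K d -> K (sigma d).
Hypothesis sz_s : forall d, K d -> sz (sigma d) = sz d.
Hypothesis X_s : forall d, K d -> sz d = 4 -> X (sigma d) = ~~ X d.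
Hypothesis X_sz : forall d, K d -> X d -> sz d = 4.
Hypothesis s_period : forall d, K d -> iter (sz d) sigma d = d.
Hypothesis s_min : forall d j, K d -> 0 < j < sz d -> iter j sigma d <> d.
Hypothesis sz_gt0 : forall d, K d -> 0 < sz d.
Hypothesis tau3 : forall d, K d -> sigma (e (sigma (e (sigma (e d))))) = d.
Hypothesis tau_neq : forall d, K d -> sigma (e d) <> d.
Hypothesis tau_exit : forall d, K d -> X d -> ~~ X (sigma (e d)).
Variables (types : seq (nat * bool)) (lim : nat -> nat).
Hypothesis K_types : forall d, K d -> (sz d, X d) \in types.
Hypothesis K_lim : forall s, #|[set d | K d && (sz d == s)]| <= s * lim s.

(* [T] describes a part of the map on [D], its points being placed at [m]. *)
Record realizes (T : table) (m : point -> D) : Prop := Realizes {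
  real_K : forall p, valid T p -> K (m p);
  real_sz : forall p, valid T p -> sz (m p) = (piece T p).1;
  real_X : forall p, valid T p -> X (m p) = exit T p;
  real_after : forall p, valid T p -> m (after T p) = sigma (m p);
  real_inj : forall p q, valid T p -> valid T q -> m p = m q -> p = q;
  real_partner : forall p q, partner T p = Some q ->
    [/\ valid T p, valid T q & m q = e (m p)];
  real_sym : forall p q, partner T p = Some q -> partner T q = Some p;
  real_open : forall p, valid T p -> partner T p = None -> p \in open_points T }.

Lemma real_glue T m p q : realizes T m -> valid T p -> valid T q ->
  partner T p = None -> partner T q = None -> m q = e (m p) -> realizes (glue T p q) m.
Proof.
case=> rK rsz rX rs ri rp ry ro vp vq np nq mq.
have pq : p == q = false by apply/eqP=> E; apply: (@e_neq (m p)); rewrite -mq E.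
split=> // [x y|x y|x vx]; rewrite !partner_glue.
- case: eqP => [->|_]; first by move=> [<-]; rewrite mq eK.
  by case: eqP => [->|_]; [move=> [<-] | apply: rp].
- case: eqP => [->|_]; first by move=> [<-]; rewrite pq eqxx.
  case: eqP => [->|_]; first by move=> [<-]; rewrite eqxx.
  move=> /ry E; case: eqP => [yq|_]; first by rewrite yq nq in E.
  by case: eqP => [yp|_]; first by rewrite yp np in E.
- case: eqP => // xq; case: eqP => // xp nx.
  by rewrite mem_filter !eqptE (introF eqP xp) (introF eqP xq) ro.
Qed.

Section Realized.
Variables (T : table) (m : point -> D).
Hypothesis R : realizes T m.

Lemma real_turn p q : valid T p -> turn T p = Some q ->
  valid T q /\ m q = sigma (e (m p)).
Proof.
move=> vp; rewrite /turn; case E: (partner T p) => [p'|//] [<-].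
have [_ vp' <-] := real_partner R E.
by rewrite (real_after R vp') valid_after.
Qed.

Lemma real_triangle p : valid T p -> triangle_ok T p.
Proof.
move=> vp; rewrite /triangle_ok; case E1: (turn T p) => [p1|//].
have [v1 m1] := real_turn vp E1; rewrite -!(real_X R) //.
have kp := real_K R vp; have k1 := real_K R v1; rewrite eqptE.
apply/and3P; split.
- by apply/eqP=> E; apply: (tau_neq kp); rewrite -m1 E.
- by apply/andP=> -[xp]; apply/negP; rewrite m1 tau_exit.
case E2: (turn T p1) => [p2|//]; have [v2 m2] := real_turn v1 E2.
have k2 := real_K R v2; rewrite -!(real_X R) //; apply/andP; split.
  apply/andP=> -[x2 /orP [xp|x1]].
    by move/negP: (tau_exit k2 x2); rewrite m2 m1 tau3.
  by move/negP: (tau_exit k1 x1); rewrite -m2.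
case E3: (turn T p2) => [p3|//]; have [v3 m3] := real_turn v2 E3.
rewrite eqptE; apply/eqP; apply: (real_inj R) => //.
by rewrite m3 m2 m1 tau3.
Qed.

Lemma real_local p : valid T p -> local_ok T p.
Proof.
move=> vp; apply: real_triangle; elim: 2 p vp => //= n IH p vp.
by case E: partner => [q|//]; have [_ vq _] := real_partner R E; apply: IH.
Qed.

(** Every piece of size [s] occupies [s] links of that size, and the placement [m] is injective. *)
Lemma real_pieces s : 0 < s -> count (fun u => eqn u.1 s) (pieces T) <= lim s.
Proof.
move=> s0; rewrite -(leq_pmul2l s0) -count_points; apply: leq_trans (K_lim s).
set L := [seq p <- points T | _].
have Um : uniq (map m L).
  rewrite map_inj_in_uniq ?filter_uniq ?points_uniq // => p q.
  by rewrite !mem_filter !mem_points => /andP [_ vp] /andP [_ vq]; apply: (real_inj R).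
rewrite -(size_map m) -(card_uniqP Um); apply/subset_leq_card/subsetP=> d.
case/mapP=> p; rewrite mem_filter mem_points eqnE => /andP [/eqP s_p vp] ->.
by rewrite inE (real_K R) ?(real_sz R) // s_p eqxx.
Qed.

Lemma real_image_iter p j : valid T p -> exists2 q, valid T q & m q = iter j sigma (m p).
Proof.
move=> vp; elim: j => [|j [q vq mq]]; first by exists p.
by exists (after T q); rewrite ?valid_after // (real_after R vq) mq.
Qed.

Lemma iter_s_K d j : K d -> K (iter j sigma d).
Proof. by move=> kd; elim: j => //= j; apply: K_s. Qed.

Lemma iter_s_size d j : K d -> sz (iter j sigma d) = sz d.
Proof. by move=> kd; elim: j => //= j IH; rewrite sz_s ?iter_s_K. Qed.

Lemma iter_s_X d j : K d ->
  X (iter j sigma d) = eqn (sz d) 4 && (X d (+) odd j).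
Proof.
move=> kd; rewrite eqnE; case: eqP => [s4|s4] /=; last first.
  by apply/negP=> /(X_sz (iter_s_K j kd)); rewrite iter_s_size.
elim: j => [|j IH] /=; first by rewrite addbF.
by rewrite X_s ?iter_s_K ?iter_s_size // IH addbN.
Qed.

Lemma iter_s_inj d i j : K d -> i < sz d -> j < sz d ->
  iter i sigma d = iter j sigma d -> i = j.
Proof.
move=> kd; wlog ij : i j / i < j.
  by move=> H; case: (ltngtP i j) => // h ? ? /esym h'; [|symmetry];
    apply: H => //; rewrite h'.
move=> _ js E; case: (@s_min d (sz d - j + i) kd).
  by rewrite addn_gt0 subn_gt0 js /=; lia.
by rewrite iterD E -iterD subnK ?(ltnW js) // s_period.
Qed.

Lemma real_add_piece d : K d -> (forall q, valid T q -> m q <> d) ->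
  exists m', [/\ realizes (add_piece T (sz d, X d)) m',
    m' (size (pieces T), 0) = d & forall q, valid T q -> m' q = m q].
Proof.
move=> kd new; set t := (sz d, X d); pose n := size (pieces T).
pose m' (q : point) := if q.1 == n then iter q.2 sigma d else m q.
have valid_lt q : valid T q -> q.1 < n.
  by rewrite /valid /piece; case: (ltnP q.1 n) => // h; rewrite nth_default.
have pieceE q : piece (add_piece T t) q = if q.1 == n then t else piece T q.
  rewrite /piece nth_rcons -/n; case: (ltngtP q.1 n) => // h.
  by rewrite nth_default // ltnW.
have vE q : valid (add_piece T t) q = if q.1 == n then q.2 < sz d else valid T q.
  by rewrite /valid pieceE; case: eqP.
have m'new q : q.1 = n -> m' q = iter q.2 sigma d by rewrite /m' => ->; rewrite eqxx.
have m'old q : valid T q -> m' q = m q.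
  by move/valid_lt; rewrite /m' ltn_neqAle => /andP [/negbTE ->].
(* The part already placed is stable under [sigma]; if it met the orbit of [d], it would contain [d]
   itself. *)
have apart q j : valid T q -> j < sz d -> m q <> iter j sigma d.
  move=> vq js E; have [q' vq' mq'] := real_image_iter (sz d - j) vq.
  by apply: (new q' vq'); rewrite mq' E -iterD subnK ?s_period // ltnW.
exists m'; split=> //; last exact: m'new.
split=> [q|q|q|q|q1 q2|q q'|q q'|q]; rewrite ?vE.
  - case: eqP => [/m'new ->|_ v]; first by rewrite iter_s_K.
    by rewrite m'old // (real_K R).
  - rewrite pieceE; case: eqP => [/m'new ->|_ v]; first by rewrite iter_s_size.
    by rewrite m'old // (real_sz R).
  - rewrite /exit pieceE; case: eqP => [/m'new ->|_ v]; first by rewrite iter_s_X.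
    by rewrite m'old // (real_X R).
  - case: eqP => [qn js|qn v].
      rewrite /after pieceE qn eqxx !m'new //= eqnE; case: eqP => [jE|_] //=.
      by rewrite -iterS jE s_period.
    have -> : after (add_piece T t) q = after T q.
      by rewrite /after pieceE; case: eqP.
    by rewrite !m'old ?valid_after // (real_after R).
  - case: eqP => [/[dup] q1n /m'new ->|_ v1]; case: eqP => [/[dup] q2n /m'new ->|_ v2].
    + move=> i1 i2 /(iter_s_inj kd i1 i2); rewrite [q1]surjective_pairing.
      by rewrite [q2]surjective_pairing q1n q2n /= => ->.
    + by move=> j; rewrite m'old // => /esym /apart [].
    + by move=> j; rewrite m'old // => /apart [].
    + by rewrite !m'old //; apply: (real_inj R).
  - move=> E; have [vq vq' mq'] := real_partner R E.
    by split; rewrite ?vE ?ltn_eqF ?valid_lt // !m'old.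
  - exact: (real_sym R).
  - rewrite mem_cat => vq nq; case: eqP vq => [qn js|_ vq]; last first.
      by rewrite (real_open R).
    apply/orP; right; apply/mapP; exists q.2; first by rewrite mem_iota.
    by rewrite -/n -qn; case: (q).
Qed.

Lemma real_extend p : valid T p -> partner T p = None ->
  (forall q, valid T q -> m q <> e (m p)) ->
  let t := (sz (e (m p)), X (e (m p))) in
  exists m', realizes (extend T p t) m' /\ realizes (add_piece T t) m'.
Proof.
move=> vp np new t; have kd : K (e (m p)) by apply/K_e/(real_K R).
have [m' [RA m'new m'old]] := real_add_piece kd new.
have old q : valid T q -> valid (add_piece T t) q.
  rewrite /valid /piece /= nth_rcons; case: (ltnP q.1) => // h.
  by rewrite nth_default.
exists m'; split=> //; apply: real_glue => //.
- exact: old.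
- by rewrite /valid /piece /= nth_rcons ltnn eqxx; apply: sz_gt0.
- case E: partner => [q|//]; have [] := real_partner R E.
  by rewrite /valid /piece nth_default.
- by rewrite m'new m'old.
Qed.

End Realized.

(** The branch to follow is dictated by [e (m p)] at the chosen point [p]. If this link is already
    placed, its point is still open and is tried as a partner; otherwise it starts a new piece,
    whose type is tried. The local tests cannot fail on a realized table, so the branch survives
    down to a leaf. *)
Lemma search_realizes (P : table -> bool) fuel T m :
  realizes T m -> all P (search types lim fuel T) ->
  exists T' m', realizes T' m' /\ P T'.
Proof.
elim: fuel T m => [|n IH] T m R /=; first by rewrite andbT => PT; exists T, m.
case: (choose T) => [p|]; last by rewrite /= andbT => PT; exists T, m.
case: ifP => [/andP [vp np]|_]; last by rewrite /= andbT => PT; exists T, m.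
rewrite all_cat !all_flatten !all_map !all_filter => /andP [/allP glued /allP added].
have {}np : partner T p = None by case: partner np.
have [/hasP [q]|none] := boolP (has (fun q => m q == e (m p)) (points T)).
  rewrite mem_points => vq /eqP mq.
  have pq : eqpt q p = false.
    by rewrite eqptE; apply/eqP=> E; apply: (@e_neq (m p)); rewrite -mq E.
  have nq : partner T q = None.
    case E: partner => [q'|//]; have [_ vq' mq'] := real_partner R E.
    have := real_sym R E; rewrite (_ : q' = p) ?np //; apply: (real_inj R) => //.
    by rewrite mq' mq eK.
  have R' := real_glue R vp vq np nq mq.
  have := glued q (real_open R vq nq); rewrite /= pq /=.
  by rewrite /checked !(real_local R') //; apply: IH R'.
have new q : valid T q -> m q <> e (m p).
  by rewrite -mem_points => qT; apply/eqP; apply: (hasPn none).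
have [m' [R' RA]] := real_extend R vp np new.
set t := (_, _) in R' RA; have kd : K (e (m p)) by apply/K_e/(real_K R).
have := added t; rewrite K_types // => /(_ isT) /=.
(* The table with the new piece is realized too, so even its number of pieces respects the limit;
   this yields the strict inequality for [T]. *)
have -> : may_extend lim T t.
  have := real_pieces RA (s := t.1) (sz_gt0 kd).
  by rewrite /= -cats1 count_cat /= eqnE eqxx addn1.
have [v1 v2 _] : [/\ valid (extend T p t) p, valid (extend T p t) (size (pieces T), 0)
    & m' (size (pieces T), 0) = e (m' p)].
  by apply: (real_partner R'); rewrite partner_glue eqxx; case: eqP => // <-.
by rewrite /checked !(real_local R') //; apply: IH R'.
Qed.

Lemma real_root d : K d -> exists m, realizes (root (sz d, X d)) m.
Proof.
move=> kd; have R0 : realizes (Table [::] [::] [::]) (fun=> d).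
  by split=> [p|p|p|p|p q|p q|p q|p]; rewrite /valid /piece /partner /= ?nth_nil.
have [q|m' [R _ _]] := real_add_piece R0 kd; last by exists m'.
by rewrite /valid /piece nth_nil.
Qed.

Section Complete.
Variables (T : table) (m : point -> D).
Hypothesis R : realizes T m.
Hypothesis closed : open_points T = [::].
Hypothesis K_connected : forall P : pred D, (forall d, K d -> P d -> P (e d) /\ P (sigma d)) ->
  (exists2 d, K d & P d) -> forall d, K d -> P d.

Lemma real_complete p : valid T p -> exists q, partner T p = Some q.
Proof.
move=> vp; case E: partner => [q|]; first by exists q.
by have := real_open R vp E; rewrite closed.
Qed.

(** The image of a closed table is stable under [e] and [sigma], hence is everything by
    connectedness. *)
Lemma real_onto d : points T != [::] -> K d -> exists2 p, valid T p & m p = d.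
Proof.
move=> Tn kd; have [] : exists2 p, p \in points T & d = m p; last first.
  by move=> p; rewrite mem_points => vp ->; exists p.
apply/mapP; move: d kd; apply: K_connected => [d _ /mapP [p]|].
  rewrite mem_points => vp ->; have [q E] := real_complete vp.
  have [_ vq <-] := real_partner R E.
  by rewrite -(real_after R) // !map_f ?mem_points ?valid_after.
case Ep: (points T) Tn => [//|p s] _; exists (m p); last by rewrite /= inE eqxx.
by apply: (real_K R); rewrite -mem_points Ep inE eqxx.
Qed.

Lemma real_card : points T != [::] -> size (points T) = #|[set d | K d]|.
Proof.
move=> Tn; have Um : uniq [seq m p | p <- points T].
  rewrite map_inj_in_uniq ?points_uniq // => p q.
  by rewrite !mem_points; apply: (real_inj R).
rewrite -(size_map m) -(card_uniqP Um); apply: eq_card => d; rewrite inE.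
apply/mapP/idP => [[p]|kd]; first by rewrite mem_points => vp ->; apply: (real_K R).
by have [p vp <-] := real_onto Tn kd; exists p; rewrite ?mem_points.
Qed.
End Complete.

End Realization.

(** * An isomorphism invariant and 3-connectivity *)

(** The three neighbours of [x] are sent injectively to the three neighbours of [f x], so adjacency
    is reflected as well. *)
Lemma graph_iso_of_hom (G1 G2 : sgraph) (f : G1 -> G2) : cubic G1 -> cubic G2 ->
  bijective f -> (forall x y, adj x y -> adj (f x) (f y)) -> graph_iso G1 G2.
Proof.
move=> /forallP c1 /forallP c2 bf hom; have fi := bij_inj bf; exists f => // x y.
have /eqP E : f @: [set y | adj x y] == [set z | adj (f x) z].
  rewrite eqEcard card_imset // (eqP (c1 x)) (eqP (c2 (f x))) leqnn andbT.
  by apply/subsetP=> z /imsetP [w]; rewrite inE => a ->; rewrite inE hom.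
have := mem_imset [set y | adj x y] y fi; rewrite E !inE //.
Qed.

Section Invariant.
Variable G : sgraph.
Definition nbr_sum (h : G -> nat) (v : G) := \sum_(w | adj v w) h w.
(* In a fullerene [closed5 v] is the number of pentagons at [v]. *)
Definition closed5 (v : G) := (iter 5 nbr_sum (fun w => nat_of_bool (w == v)) v)./2.
(** With adjacency matrix $A$ and $p$ = [closed5] this is $p^T A^5 p$: walks of length 5 weighted by
    the values of [closed5] at both ends. It separates the eighteen graphs. *)
Definition pent_walks := \sum_(v : G) closed5 v * iter 5 nbr_sum closed5 v.
End Invariant.

Lemma graph_iso_pent_walks G1 G2 : graph_iso G1 G2 -> pent_walks G1 = pent_walks G2.
Proof.
case=> f bf adjf; have fi := bij_inj bf.
have sumE k h1 h2 v : (forall w, h1 w = h2 (f w)) ->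
    iter k (@nbr_sum G1) h1 v = iter k (@nbr_sum G2) h2 (f v).
  move=> hh; elim: k v => //= k IH v; rewrite /nbr_sum (reindex f) /=; last exact: onW_bij.
  by apply: eq_big => w; rewrite ?adjf //; move=> _; apply: IH.
have cE v : closed5 v = closed5 (f v).
  rewrite /closed5 (sumE 5 _ (fun w => nat_of_bool (w == f v))) // => w.
  by rewrite (inj_eq fi).
rewrite /pent_walks [RHS](reindex f); last exact: onW_bij.
by apply: eq_bigr => v _; rewrite cE (sumE 5 _ (@closed5 G2)).
Qed.

(* [ring v] is the cycle that bounds the union of the faces at [v]. *)
Section ThreeConnected.
Variables (G : sgraph) (ring : G -> seq G).
Hypothesis cubicG : cubic G.
Hypothesis connG : connected G.
Hypothesis ring_cycle : forall v, path.cycle (@adj G) (ring v).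
Hypothesis ring_uniq : forall v, uniq (ring v).
Hypothesis ring_avoid : forall v, v \notin ring v.
Hypothesis ring_nbr : forall v u, adj v u -> u \in ring v.
Hypothesis ring_nbr2 : forall v u w, adj v u -> adj u w -> w != v -> w \in ring v.

Section Cut.
Variable S : {set G}.
Hypothesis S_small : #|S| < 3.

Local Notation rS := [rel u v | [&& @adj G u v, u \notin S & v \notin S]].

Lemma cut_sym : connect_sym rS.
Proof. by apply: sym_connect_sym => x y /=; rewrite adj_sym andbA andbAC -andbA. Qed.

Lemma path_cut x p a b : path (@adj G) x p -> all [predC S] (x :: p) ->
  a \in x :: p -> b \in x :: p -> connect rS a b.
Proof.
move=> pp ap ain bin; have pS : path rS x p.
  apply: (sub_in_path _ ap pp) => u v; rewrite !inE => uS vS uv /=.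
  by rewrite uv uS vS.
apply: (connect_trans (y := x)); last exact: path_connect pS b bin.
by rewrite cut_sym; apply: path_connect pS a ain.
Qed.

(* The ring around a deleted vertex misses at most one further deleted vertex,
   and a cycle minus a vertex is connected. *)
Lemma ring_cut v a b : v \in S -> a \in ring v -> b \in ring v ->
  a \notin S -> b \notin S -> connect rS a b.
Proof.
move=> vS ar br aS bS; have [/hasP [u ur /= uS]|none] := boolP (has (mem S) (ring v)).
  have uv : u != v by apply: contraNneq (ring_avoid v) => E; rewrite -{1}E.
  have SE x : x \in S -> (x == u) || (x == v).
    move=> xS; apply/negPn/negP; rewrite negb_or => /andP [xu xv].
    suff : #|x |: [set u; v]| <= #|S|.
      by rewrite cardsU1 cards2 !inE negb_or xu xv uv leqNgt S_small.
    by apply/subset_leq_card/subsetP=> y; rewrite !inE => /or3P [] /eqP ->.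
  case: (rot_to ur) => i p rE.
  have mE x : x \in ring v -> x \notin S -> x \in p.
    by rewrite -(mem_rot i) rE inE => /orP [/eqP -> /negP|//]; case.
  have := ring_cycle v; rewrite -(rot_cycle i) rE /= rcons_path => /andP [up _].
  have := ring_uniq v; rewrite -(rot_uniq i) rE /= => /andP [unp _].
  have {ar}ap := mE a ar aS; have {br}bp := mE b br bS.
  have pS : all [predC S] p.
    apply/allP=> x xp; rewrite !inE; apply/negP=> /SE /orP [] /eqP xE; subst x.
      by rewrite xp in unp.
    by have := ring_avoid v; rewrite -(mem_rot i) rE inE xp orbT.
  by case: p ap bp up pS {rE unp mE} => [//|y p] ap bp /= /andP [_ yp] pS;
    apply: path_cut ap bp.
have rS : all [predC S] (ring v).
  by apply/allP=> x xr /=; apply: contra none => xS; apply/hasP; exists x.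
have := ring_cycle v; case: (ring v) ar br rS => [//|y p] ar br rS /=.
by rewrite rcons_path => /andP [pp _]; apply: path_cut ar br.
Qed.

Lemma cut_connected : connected_off S.
Proof.
apply/forallP=> x; apply/forallP=> y; apply/implyP=> xS; apply/implyP=> yS.
(* [J] is stated for deleted [u] too, so that it can be carried along a path of [G] that passes
   through [S]. *)
pose J u := forall z, z \notin S -> (z == u) || adj u z -> connect rS x z.
have Jx : J x.
  move=> z zS /orP [/eqP -> |a]; first exact: connect0.
  by apply: connect1; rewrite /= a xS zS.
have Jstep u u' : adj u u' -> J u -> J u'.
  move=> uu' Ju z zS; have [u'S|u'S] := boolP (u' \in S); last first.
    have xu' : connect rS x u' by apply: Ju => //; rewrite uu' orbT.
    case/orP=> [/eqP -> //|a]; apply: connect_trans xu' (connect1 _).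
    by rewrite /= a u'S zS.
  case/orP=> [/eqP zE|u'z]; first by rewrite zE u'S in zS.
  have [uS|uS] := boolP (u \in S); last first.
    apply: (connect_trans (Ju u uS _)); first by rewrite eqxx.
    by apply: (ring_cut u'S) => //; apply: ring_nbr; rewrite // adj_sym.
  (* Both [u] and [u'] are deleted. A surviving neighbour [w] of [u] exists because [S] has fewer
     than three elements, and [w] and [z] both lie on the ring of [u]. *)
  have [w] : exists w, w \in [set w | adj u w] :\: S.
    apply/set0Pn; rewrite -card_gt0 cardsD (eqP (forallP cubicG u)).
    by rewrite subn_gt0; apply: leq_ltn_trans S_small; apply/subset_leq_card/subsetIr.
  rewrite !inE => /andP [wS uw]; apply: (connect_trans (Ju w wS _)); first by rewrite uw orbT.
  apply: (ring_cut uS) => //; first exact: ring_nbr.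
  by apply: ring_nbr2 u'z _ => //; apply: contraNneq zS => ->.
have /forallP/(_ x)/forallP/(_ y) := connG; rewrite !inE /= => /connectP [p pp yE].
suff Jy : J y by apply: Jy; rewrite ?eqxx.
move: {1 2 3}x Jx pp yE; elim: p => [|w p IH] x' Jx' /=; first by move=> _ ->.
rewrite !inE andbT => /andP [a pp] yE.
exact: IH w (Jstep _ _ a Jx') pp yE.
Qed.
End Cut.

Lemma ring_three_connected : 3 < #|G| -> three_connected G.
Proof.
by move=> G3; rewrite /three_connected G3; apply/forallP=> S; apply/implyP; apply: cut_connected.
Qed.
End ThreeConnected.

(** * Graphs given by neighbour tables *)

Definition nxt (s : seq nat) (x : nat) :=
  if s is [:: a; b; c] then (if eqn x a then b else if eqn x b then c else a) else x.

Definition cubic_table n (T : seq (seq nat)) :=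
  all (fun v => let s := nth [::] T v in
    [&& size s == 3, uniq s & all (fun w => [&& w < n, w != v & v \in nth [::] T w]) s])
  (iota 0 n).

Section TableGraph.
Variables (n : nat) (T : seq (seq nat)).
Local Notation row v := (nth [::] T v).
Hypothesis cubicT : cubic_table n T.

Lemma row_shape v : v < n -> exists a b c,
  [/\ row v = [:: a; b; c], a != b, a != c & b != c].
Proof.
move=> vn; have := allP cubicT v; rewrite mem_iota => /(_ vn) /and3P [].
case: (row v) => [|a [|b [|c [|]]]] // _ /=; rewrite !inE negb_or andbT -andbA.
by case/and3P=> ab ac bc _; exists a, b, c.
Qed.

Lemma row_mem v w : v < n -> w \in row v -> [&& w < n, w != v & v \in row w].
Proof.
move=> vn; have := allP cubicT v; rewrite mem_iota => /(_ vn) /and3P [_ _ /allP h].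
exact: h.
Qed.

Lemma row_uniq v : v < n -> uniq (row v).
Proof. by move=> vn; have := allP cubicT v; rewrite mem_iota => /(_ vn) /and3P []. Qed.

Definition table_adj (i j : 'I_n) := val j \in row (val i).

Lemma table_adj_sym : symmetric table_adj.
Proof.
by move=> i j; apply/idP/idP=> /(row_mem (ltn_ord _)) /and3P [].
Qed.

Lemma table_adj_irrefl : irreflexive table_adj.
Proof.
by move=> i; apply/negP=> /(row_mem (ltn_ord _)) /and3P [_]; rewrite eqxx.
Qed.

Definition table_sgraph := SGraph table_adj_sym table_adj_irrefl.
Local Notation dt := (dart table_sgraph).

Lemma nxt_mem v w : v < n -> w \in row v -> nxt (row v) w \in row v.
Proof.
case/row_shape=> a [b [c [-> ab ac bc]]]; rewrite !inE /= !eqnE.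
by case/or3P=> /eqP ->; rewrite ?eqxx ?orbT //; case: ifP; rewrite ?eqxx ?orbT //;
  case: ifP; rewrite ?eqxx ?orbT.
Qed.

Lemma nxt3 v w : v < n -> w \in row v -> nxt (row v) (nxt (row v) (nxt (row v) w)) = w.
Proof.
case/row_shape=> a [b [c [-> ab ac bc]]]; rewrite !inE /= !eqnE.
have [ba ca cb] : [/\ b == a = false, c == a = false & c == b = false].
  by split; apply/negbTE; rewrite eq_sym.
by case/or3P=> /eqP ->; rewrite ?eqxx ?ba ?ca ?cb ?eqxx ?ba ?ca ?cb ?eqxx.
Qed.

Lemma nxt_orbit v w x : v < n -> w \in row v -> x \in row v ->
  [\/ x = w, x = nxt (row v) w | x = nxt (row v) (nxt (row v) w)].
Proof.
case/row_shape=> a [b [c [-> ab ac bc]]]; rewrite !inE /= !eqnE.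
have [ba ca cb] : [/\ b == a = false, c == a = false & c == b = false].
  by split; apply/negbTE; rewrite eq_sym.
by case/or3P=> /eqP -> /or3P [] /eqP ->;
  rewrite ?eqxx ?ba ?ca ?cb ?eqxx ?ba ?ca ?cb ?eqxx;
  solve [exact: Or31 | exact: Or32 | exact: Or33].
Qed.

Definition code (d : dt) : nat * nat := (val (src d), val (tgt d)).

Lemma code_inj : injective code.
Proof. by move=> d d' [/val_inj s /val_inj t]; apply: dart_inj. Qed.

Lemma code_lt (d : dt) : (code d).1 < n.
Proof. exact: ltn_ord. Qed.

Lemma code_row (d : dt) : (code d).2 \in row (code d).1.
Proof. exact: (valP d). Qed.

Lemma code_ex p : p.1 < n -> p.2 \in row p.1 -> exists d : dt, code d = p.
Proof.
case: p => x y /= xn yx; have /and3P [yn _ _] := row_mem xn yx.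
by exists (exist _ (Ordinal xn, Ordinal yn) yx : dt).
Qed.

Lemma rot_dart_lt (d : dt) : nxt (row (code d).1) (code d).2 < n.
Proof. by have /and3P [] := row_mem (code_lt d) (nxt_mem (code_lt d) (code_row d)). Qed.

Definition rot_dart (d : dt) : dt :=
  exist _ (src d, Ordinal (rot_dart_lt d)) (nxt_mem (code_lt d) (code_row d)).

Lemma code_rot d : code (rot_dart d) = ((code d).1, nxt (row (code d).1) (code d).2).
Proof. by []. Qed.

Lemma rot_dart3 d : rot_dart (rot_dart (rot_dart d)) = d.
Proof.
apply: code_inj; rewrite !code_rot /=; congr pair.
exact: (nxt3 (code_lt d) (code_row d)).
Qed.

Lemma rot_dart_inj : injective rot_dart.
Proof. by move=> d d' e; rewrite -(rot_dart3 d) e rot_dart3. Qed.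

Lemma table_rotationP d d' :
  (d' \in porbit (perm rot_dart_inj) d) = (src d' == src d).
Proof.
apply/idP/eqP=> [/porbit_iterP [i _ ->]|s].
  by elim: i => //= i <-; rewrite permE.
have row' : (code d').2 \in row (code d).1 by rewrite /code /= -s; exact: code_row.
have E : d' = iter 0 (perm rot_dart_inj) d \/ d' = iter 1 (perm rot_dart_inj) d \/
    d' = iter 2 (perm rot_dart_inj) d.
  rewrite /= !permE; have [e|e|e] := nxt_orbit (code_lt d) (code_row d) row'.
  - by left; apply: code_inj; rewrite [LHS]surjective_pairing e /code s.
  - by right; left; apply: code_inj; rewrite [LHS]surjective_pairing e /code s.
  - by right; right; apply: code_inj; rewrite [LHS]surjective_pairing e /code s.
by case: E => [->|[->|->]]; rewrite -permX mem_porbit.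
Qed.

Definition table_graph := @EmbeddedGraph table_sgraph (perm rot_dart_inj) table_rotationP.
Local Notation phi := (face_perm table_graph).

Definition face_step (p : nat * nat) := (p.2, nxt (row p.2) p.1).

Lemma code_face d : code (phi d) = face_step (code d).
Proof. by rewrite /face_perm permM !permE. Qed.

Lemma code_iter k d : code (iter k phi d) = iter k face_step (code d).
Proof. by elim: k => //= k <-; rewrite code_face. Qed.

Definition dart_codes := [seq (x, y) | x <- iota 0 n, y <- row x].

Lemma mem_dart_codes d : code d \in dart_codes.
Proof.
apply/allpairsPdep; exists (code d).1, (code d).2; split=> //; last exact: code_row.
by rewrite mem_iota code_lt.
Qed.

Lemma dart_codes_uniq : uniq dart_codes.
Proof.
apply: allpairs_uniq_dep; first exact: iota_uniq.
  by move=> x; rewrite mem_iota; apply: row_uniq.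
by move=> [x y] [x' y'] _ _ /= [-> ->].
Qed.

Lemma card_code (P : pred (nat * nat)) : #|[set d | P (code d)]| = count P dart_codes.
Proof.
have -> : #|[set d | P (code d)]| = count P (map code (enum dt)).
  rewrite count_map -size_filter cardE; apply: perm_size; apply: uniq_perm.
  - exact: enum_uniq.
  - by rewrite filter_uniq ?enum_uniq.
  - by move=> d; rewrite mem_enum inE mem_filter mem_enum andbT.
move: P; apply/seq.permP; apply: uniq_perm.
    by rewrite map_inj_uniq ?enum_uniq //; exact: code_inj.
  exact: dart_codes_uniq.
move=> p; apply/mapP/idP => [[d _ ->]|]; first exact: mem_dart_codes.
case/allpairsPdep=> x [y [+ yx ->]]; rewrite mem_iota => xn.
by have [d <-] := @code_ex (x, y) xn yx; exists d; rewrite ?mem_enum.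
Qed.

Definition is_gon k p := eqpt (iter k face_step p) p &&
  all (fun j => ~~ eqpt (iter j face_step p) p) (iota 1 k.-1).

Lemma gon_size k d : 0 < k -> is_gon k (code d) -> #|porbit phi d| = k.
Proof.
move=> k0 /andP [kp /allP mp]; apply: card_porbit_min => // [|j /andP [j0 jk]].
  by apply: code_inj; rewrite code_iter; apply/eqP; rewrite -eqptE.
move/(congr1 code)/eqP; rewrite code_iter -eqptE; apply/negP/mp.
by rewrite mem_iota j0; lia.
Qed.

Lemma table_cubic : cubic table_graph.
Proof.
apply/forallP=> x; have [a [b [c [rE ab ac bc]]]] := row_shape (ltn_ord x).
rewrite -[3]/(size [:: a; b; c]) -rE cardE -(size_map val); apply/eqP/perm_size.
apply: uniq_perm; first by rewrite map_inj_uniq ?enum_uniq //; apply: val_inj.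
  exact: row_uniq.
move=> w; apply/mapP/idP => [[y]|wr]; first by rewrite mem_enum inE => + ->.
have /and3P [wn _ _] := row_mem (ltn_ord x) wr.
by exists (Ordinal wn); rewrite ?mem_enum ?inE.
Qed.

Definition grow mask := [seq nth false mask v || has (nth false mask) (row v) | v <- iota 0 n].
Definition reached := iter n grow [:: true].

Lemma table_connected : all id reached -> size reached = n -> connected table_graph.
Proof.
move=> /all_nthP ra sr; have R (x y : table_graph) : val x = 0 ->
    connect (@adj table_graph) x y.
  move=> x0; have : nth false reached (val y) by apply: ra; rewrite sr; apply: ltn_ord.
  rewrite /reached; move: (X in iter X) => k; elim: k y => [|k IH] y /=.
    by case E: (val y) => [|y'] //=; rewrite ?nth_nil // (_ : y = x) //; apply: val_inj; rewrite E.
  have yn : val y < n by apply: ltn_ord.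
  rewrite (nth_map 0) ?size_iota // nth_iota // add0n => /orP [/IH //|/hasP [w wy nw]].
  have /and3P [wn _ yw] := row_mem yn wy.
  by apply: (connect_trans (IH (Ordinal wn) nw)); apply: connect1.
apply/forallP=> x; apply/forallP=> y; rewrite !inE /=.
have n0 : 0 < n by apply: leq_ltn_trans (ltn_ord x).
have symc : connect_sym (@adj table_graph) by apply: sym_connect_sym; apply: adj_sym.
rewrite (eq_connect (e' := @adj table_graph)); last by move=> u v; rewrite /= !inE !andbT.
apply: (connect_trans (y := Ordinal n0)); last exact: R.
by rewrite symc; apply: R.
Qed.

Fixpoint face_sources k v (p : nat * nat) : seq nat :=
  if k is k'.+1 then
    if eqn p.2 v then [::] else p.1 :: face_sources k' v (face_step p)
  else [::].

(** The face that leaves [v] through [w] returns through the neighbour before [w] in the rotation,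
    which is where the next segment must start; hence the order [[:: c; b; a]]. Each segment omits
    that neighbour. *)
Definition ring_of v : seq nat :=
  if row v is [:: a; b; c] then
    flatten [seq face_sources 6 v (face_step (v, w)) | w <- [:: c; b; a]]
  else [::].

Definition ring_ok v := let s := ring_of v in
  [&& path.cycle (fun x y => y \in row x) s, uniq s, all (ltn^~ n) s, v \notin s &
    all (fun u => (u \in s) && all (fun w => (w == v) || (w \in s)) (row u)) (row v)].

Lemma table_three_connected : connected table_graph -> 3 < n ->
  all ring_ok (iota 0 n) -> three_connected table_graph.
Proof.
move=> con n3 /allP rok; have {}rok (v : table_graph) : ring_ok v.
  by apply: rok; rewrite mem_iota ltn_ord.
pose ring (v : table_graph) : seq table_graph := pmap insub (ring_of v).
have ringE v : map val (ring v) = ring_of v.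
  rewrite /ring pmap_filter; last exact: insubK.
  by apply/all_filterP/allP=> x xr; have /and5P [_ _ /allP/(_ x xr) xn _ _] := rok v;
    rewrite insubT.
have memE v (w : table_graph) : (w \in ring v) = (val w \in ring_of v).
  by rewrite -ringE mem_map //; apply: val_inj.
apply: (@ring_three_connected _ ring); rewrite ?card_ord //; first exact: table_cubic.
- move=> v; have /and5P [+ _ _ _ _] := rok v; rewrite -ringE.
  by rewrite cycle_map.
- by move=> v; have /and5P [_ + _ _ _] := rok v; rewrite -ringE map_inj_uniq //; apply: val_inj.
- by move=> v; have /and5P [_ _ _ + _] := rok v; rewrite memE.
- by move=> v u vu; have /and5P [_ _ _ _ /allP/(_ _ vu)/andP [+ _]] := rok v; rewrite memE.
- move=> v u w vu uw wv; have /and5P [_ _ _ _ /allP/(_ _ vu)/andP [_ /allP/(_ _ uw)]] := rok v.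
  by rewrite memE => /orP [|//]; rewrite (inj_eq val_inj) (negbTE wv).
Qed.

(** Sixty darts on pentagons give 12 pentagons, hence 20 hexagons among 180 darts, and the Euler
    relation becomes 60 + 32 = 90 + 2. *)
Definition fullerene_table :=
  [&& n == 60, all (fun p => is_gon 5 p || is_gon 6 p) dart_codes,
      count (is_gon 5) dart_codes == 60, all id reached, size reached == n
    & all ring_ok (iota 0 n)].

Section Fullerene.
Hypothesis fT : fullerene_table.

Lemma table_gon d : is_gon 5 (code d) \/ is_gon 6 (code d).
Proof.
have /and5P [_ /allP gon _ _ _] := fT.
by have /orP := gon _ (mem_dart_codes d).
Qed.

Lemma table_face5 d : (#|porbit phi d| == 5) = is_gon 5 (code d).
Proof.
case: (boolP (is_gon 5 _)) => [g|ng]; first by rewrite (gon_size _ g).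
by case: (table_gon d) => g; [rewrite g in ng | rewrite (gon_size _ g)].
Qed.

Lemma table_faces : faces table_graph == pentagons table_graph :|: hexagons table_graph.
Proof.
apply/eqP/setP=> f; rewrite !inE -andb_orr; apply/esym/andb_idr => /imsetP [d _ ->].
by case: (table_gon d) => g; rewrite (gon_size _ g).
Qed.

Lemma table_fullerene60 : fullerene60 table_graph.
Proof.
have /and5P [/eqP n60 _ /eqP c5 ra /andP [/eqP sr rings]] := fT.
have con : connected table_graph by apply: table_connected.
have V60 : #|table_graph| = 60 by rewrite card_ord.
have c3 := table_cubic; have fE := table_faces.
rewrite /fullerene60 V60 eqxx andbT; apply/and4P; split=> //; last first.
  by apply: table_three_connected => //; rewrite n60.
rewrite /plane con /= V60; have := card_edges c3; have := card_faces fE.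
have := card_pent_hex c3 fE; have : #|pentagons table_graph| * 5 = 60.
  rewrite card_porbits_size -c5 -card_code; apply: eq_card => d.
  by rewrite !inE table_face5.
rewrite V60 -[edges table_sgraph]/(edges table_graph).
by move: #|pentagons _| #|hexagons _| #|faces _| #|edges _| => p h F E; lia.
Qed.
End Fullerene.

Definition pent_walks_table :=
  let s f v := sumn [seq f w | w <- row v] in
  let c := [seq (iter 5 s (fun w => nat_of_bool (eqn w v)) v)./2 | v <- iota 0 n] in
  sumn [seq nth 0 c v * iter 5 s (nth 0 c) v | v <- iota 0 n].

Lemma nbr_sum_table k f h (v : table_graph) : (forall w : table_graph, f w = h (val w)) ->
  iter k (@nbr_sum table_graph) f v = iter k (fun g x => sumn [seq g w | w <- row x]) h (val v).
Proof.
move=> fh; elim: k v => //= k IH v; rewrite /nbr_sum.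
set g := iter k _ h; under eq_bigr do rewrite IH -/g.
rewrite sumnE big_map -(big_mkord (fun w => w \in row v) g) -big_filter.
apply: perm_big; apply: uniq_perm; rewrite ?filter_uniq ?iota_uniq ?row_uniq //.
move=> w; rewrite mem_filter mem_index_iota /=; apply/andb_idr.
by move/(row_mem (ltn_ord v))/and3P=> [].
Qed.

Lemma pent_walks_tableE : pent_walks table_graph = pent_walks_table.
Proof.
rewrite /pent_walks_table; set s := (fun _ _ => sumn _) .
set c := [seq half _ | v <- _].
have cE (v : table_graph) : closed5 v = nth 0 c v.
  rewrite (nth_map 0) ?size_iota // nth_iota // add0n /closed5.
  by rewrite (@nbr_sum_table 5 _ (fun w => nat_of_bool (eqn w v))).
rewrite sumnE big_map -[iota 0 n](_ : index_iota 0 n = _); last by rewrite /index_iota subn0.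
rewrite big_mkord; apply: eq_bigr => v _.
by rewrite cE (@nbr_sum_table 5 _ (nth 0 c)).
Qed.

(** The perfect matching that shows the Clar number to be at least 8: in the numbering of
    [clar_gluings] it consists of three alternate edges of each of the eight hexagons and of the six
    extra edges. *)
Definition mate x := if odd x then x.-1 else x.+1.

(* In a table built from eight hexagons and six edges, [covering] marks the
   darts running along the boundaries of the eight hexagons. *)
Definition covering (p : nat * nat) := (p.1 < 48) && eqn p.2 (nth 0 (row p.1) 2).

Definition clar_table :=
  [&& all (fun p => [&& covering (face_step p) == covering p, covering p ==> is_gon 6 p
        & covering p ==> (eqn p.2 (mate p.1) != eqn (face_step p).2 (mate p.2))]) dart_codes,
      count covering dart_codes == 48 & all (fun v => mate v \in row v) (iota 0 n)].

Lemma mateK x : mate (mate x) = x.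
Proof.
by rewrite /mate; case ox: (odd x) => /=; [case: x ox => //= x /negbTE -> | rewrite ox].
Qed.

Lemma table_clar : clar_table -> exists2 H : {set {set dart table_graph}},
  sextet_pattern H & #|H| = 8.
Proof.
case/and3P=> /allP ok /eqP c48 /allP mateT.
have cov_face d : covering (code (phi d)) = covering (code d).
  by rewrite code_face; have /and3P [/eqP] := ok _ (mem_dart_codes d).
have cov_gon d : covering (code d) -> #|porbit phi d| = 6.
  move=> cd; apply: gon_size => //.
  by have /and3P [_ /implyP/(_ cd)] := ok _ (mem_dart_codes d).
have cov_orbit d d' : d' \in porbit phi d -> covering (code d') = covering (code d).
  by case/porbit_iterP=> i _ ->; elim: i => //= i <-.
have cov_src d d' : covering (code d) -> covering (code d') -> src d = src d' -> d = d'.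
  move=> /andP [_ /eqP t] /andP [_ /eqP t'] s; apply: code_inj.
  by rewrite [LHS]surjective_pairing [RHS]surjective_pairing t t' /code s.
pose H := [set porbit phi d | d in [set d | covering (code d)]].
pose m (d : dt) := val (tgt d) == mate (val (src d)).
have m_rev d : m (rev_dart d) = m d.
  rewrite /m src_rev tgt_rev; apply/eqP/eqP => ->; by rewrite mateK.
pose M := [set dart_edge d | d in [set d | m d]].
have memM d : (dart_edge d \in M) = m d.
  apply/imsetP/idP => [[d' + /dart_edge_eq [->|->]]|md]; rewrite ?inE ?m_rev //.
  by exists d; rewrite ?inE.
have Hmem d : (porbit phi d \in H) = covering (code d).
  apply/imsetP/idP => [[d' + E]|cd]; last by exists d; rewrite ?inE.
  by rewrite inE (cov_orbit d d') // E porbit_id.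
have HE f d : f \in H -> d \in f -> covering (code d) /\ f = porbit phi d.
  case/imsetP=> d0; rewrite inE => c0 -> dd0; split; first by rewrite (cov_orbit _ _ dd0).
  by apply/eqP; rewrite eq_sym -mem_porbit_eq.
exists H; last first.
  have sub : H \subset porbits phi by apply/subsetP=> f /imsetP [d _ ->]; apply: imset_f.
  have := card_porbits_uniform sub (k := 6); rewrite (_ : #|[set x | _]| = 48).
    move=> E; have {}E : 48 = #|H| * 6.
      by apply: E => f /imsetP [d + ->]; rewrite inE => /cov_gon.
    by move: #|H| E => h E; lia.
  by rewrite -c48 -card_code; apply: eq_card => d; rewrite !inE Hmem.
apply/and3P; split.
- apply/subsetP=> f /imsetP [d]; rewrite !inE => cd ->.
  by rewrite imset_f //= cov_gon.
- apply/forallP=> f; apply/implyP=> fH; apply/forallP=> g; apply/implyP=> gH.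
  apply/implyP=> fg; apply/pred0P=> v /=; apply/negP=> /andP [/imsetP [d df ->]].
  case/imsetP=> d' dg s; have [cd fE] := HE _ _ fH df; have [cd' gE] := HE _ _ gH dg.
  by case/eqP: fg; rewrite fE gE (cov_src d d').
apply/existsP; exists M; apply/andP; split.
  apply/andP; split; first by apply/subsetP=> E /imsetP [d _ ->]; apply/edgesP; exists d.
  apply/forallP=> v; have mv : mate v \in row v by apply: mateT; rewrite mem_iota ltn_ord.
  have [d [dv dm]] := @code_ex (val v, mate v) (ltn_ord v) mv.
  have sv : src d = v by apply: val_inj.
  have md : m d by rewrite /m sv; apply/eqP.
  have m_src d' : m d' -> src d' = v -> d' = d.
    move=> /eqP md' s; apply: dart_inj; rewrite ?sv //.
    by apply: val_inj; rewrite md' (eqP md) s sv.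
  apply/cards1P; exists (dart_edge d); apply/setP=> E; rewrite !inE.
  apply/andP/eqP => [[/imsetP [d' + ->]]|->]; last first.
    by rewrite memM md /dart_edge sv !inE eqxx.
  rewrite !inE => md' /orP [] /eqP vE; first by rewrite (m_src d').
  by rewrite -dart_edge_rev (m_src (rev_dart d')) ?m_rev.
apply/forallP=> f; apply/implyP=> fH; apply/forallP=> d; apply/implyP=> df.
have [cd _] := HE _ _ fH df; have /and3P [_ _ /implyP/(_ cd)] := ok _ (mem_dart_codes d).
have sf : src (phi d) = tgt d := @src_face table_graph d.
by rewrite -code_face !memM /m /code !eqnE /= sf.
Qed.

Definition isolated_table :=
  all (fun p => is_gon 5 p ==> ~~ is_gon 5 (p.2, p.1)) dart_codes.

Lemma table_isolated : fullerene_table -> isolated_table -> isolated_pentagons table_graph.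
Proof.
move=> fT /allP iso; apply/forallP=> f; apply/implyP=> fP; apply/forallP=> g.
apply/implyP=> gP; apply/implyP=> fg; apply/pred0P=> E /=; apply/negP.
case/andP=> /imsetP [d df ->] /imsetP [d' dg e].
have dd' := @dart_edge_eq table_sgraph d' d e.
have face5 h x : h \in pentagons table_graph -> x \in h ->
    h = porbit phi x /\ is_gon 5 (code x).
  rewrite inE => /andP [ho /eqP h5] xh; have hE := porbits_mem ho xh.
  by rewrite -table_face5 // -hE h5.
have [fE f5] := face5 _ _ fP df; have [gE g5] := face5 _ _ gP dg.
case: dd' => dE; first by case/eqP: fg; rewrite fE gE dE.
have := implyP (iso _ (mem_dart_codes d')) g5.
by rewrite dE in f5; rewrite -[(_, _)]/(code (rev_dart d')) f5.
Qed.

End TableGraph.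

(** * The eighteen graphs *)

(* The first 48 entries give, for the vertices [6 a + j] of the hexagons
   [a < 8], the neighbour off the hexagon; entries [48 + 4 i + 2 b + k] give, for
   the ends [48 + 2 i + b] of the edges [i < 6], the two remaining neighbours. *)
Definition clar_gluings : seq (seq nat) := [::
  [::
    48; 23; 50; 24; 52; 7; 49; 5; 52; 41; 56; 13; 49; 11; 57; 42; 54; 19; 48;
    17; 54; 31; 51; 1; 3; 50; 35; 58; 37; 53; 51; 21; 55; 46; 58; 26; 53; 28;
    59; 44; 56; 9; 15; 57; 39; 59; 33; 55; 18; 0; 6; 12; 25; 2; 22; 30; 8; 4;
    29; 36; 20; 16; 47; 32; 10; 40; 43; 14; 27; 34; 45; 38];
  [::
    48; 23; 50; 24; 52; 7; 49; 5; 53; 41; 56; 13; 49; 11; 56; 42; 55; 19; 48;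
    17; 54; 31; 50; 1; 3; 51; 35; 58; 37; 52; 51; 21; 54; 46; 59; 26; 53; 28;
    58; 44; 57; 9; 15; 57; 39; 59; 33; 55; 18; 0; 6; 12; 2; 22; 30; 25; 4; 29;
    36; 8; 32; 20; 16; 47; 14; 10; 40; 43; 38; 27; 34; 45];
  [::
    48; 23; 50; 24; 52; 7; 49; 5; 53; 41; 56; 13; 49; 11; 57; 42; 54; 19; 48;
    17; 54; 31; 50; 1; 3; 51; 35; 58; 37; 52; 51; 21; 55; 46; 59; 26; 53; 28;
    58; 44; 56; 9; 15; 57; 39; 59; 33; 55; 18; 0; 6; 12; 2; 22; 30; 25; 4; 29;
    36; 8; 20; 16; 47; 32; 10; 40; 43; 14; 38; 27; 34; 45];
  [::
    48; 23; 50; 24; 52; 7; 49; 5; 53; 41; 56; 13; 49; 11; 57; 42; 54; 19; 48;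
    17; 54; 31; 50; 1; 3; 51; 35; 58; 37; 52; 51; 21; 55; 46; 58; 26; 53; 28;
    59; 44; 56; 9; 15; 57; 39; 59; 33; 55; 18; 0; 6; 12; 2; 22; 30; 25; 4; 29;
    36; 8; 20; 16; 47; 32; 10; 40; 43; 14; 27; 34; 45; 38];
  [::
    48; 23; 50; 24; 52; 7; 49; 5; 53; 41; 56; 13; 49; 11; 56; 42; 54; 19; 48;
    17; 54; 31; 50; 1; 3; 51; 35; 58; 37; 52; 51; 21; 55; 46; 58; 26; 53; 28;
    59; 44; 57; 9; 15; 57; 39; 59; 33; 55; 18; 0; 6; 12; 2; 22; 30; 25; 4; 29;
    36; 8; 20; 16; 47; 32; 14; 10; 40; 43; 27; 34; 45; 38];
  [::
    48; 23; 50; 24; 52; 7; 49; 5; 53; 41; 56; 13; 49; 11; 57; 42; 55; 19; 48;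
    17; 54; 31; 50; 1; 3; 51; 35; 58; 37; 52; 51; 21; 54; 46; 58; 26; 53; 28;
    59; 44; 56; 9; 15; 57; 39; 59; 33; 55; 18; 0; 6; 12; 2; 22; 30; 25; 4; 29;
    36; 8; 32; 20; 16; 47; 10; 40; 43; 14; 27; 34; 45; 38];
  [::
    48; 23; 50; 24; 52; 7; 49; 5; 53; 41; 56; 13; 49; 11; 56; 42; 55; 19; 48;
    17; 54; 31; 50; 1; 3; 51; 35; 58; 37; 52; 51; 21; 54; 46; 58; 26; 53; 28;
    59; 44; 57; 9; 15; 57; 39; 59; 33; 55; 18; 0; 6; 12; 2; 22; 30; 25; 4; 29;
    36; 8; 32; 20; 16; 47; 14; 10; 40; 43; 27; 34; 45; 38];
  [::
    48; 23; 24; 30; 50; 7; 49; 5; 51; 53; 36; 13; 49; 11; 41; 47; 56; 19; 48;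
    17; 57; 58; 25; 1; 2; 22; 58; 44; 54; 31; 3; 29; 54; 38; 52; 50; 10; 53;
    33; 55; 42; 14; 40; 55; 27; 59; 56; 15; 18; 0; 6; 12; 4; 35; 52; 8; 51;
    34; 37; 9; 32; 28; 43; 39; 16; 46; 59; 20; 26; 21; 57; 45];
  [::
    48; 23; 24; 30; 50; 7; 49; 5; 51; 53; 36; 13; 49; 11; 41; 47; 56; 19; 48;
    17; 56; 58; 25; 1; 2; 22; 59; 44; 54; 31; 3; 29; 54; 38; 52; 50; 10; 53;
    33; 55; 42; 14; 40; 55; 27; 59; 57; 15; 18; 0; 6; 12; 4; 35; 52; 8; 51;
    34; 37; 9; 32; 28; 43; 39; 20; 16; 46; 58; 21; 57; 45; 26];
  [::
    48; 23; 24; 30; 50; 7; 49; 5; 50; 52; 36; 13; 49; 11; 41; 47; 56; 19; 48;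
    17; 56; 58; 25; 1; 2; 22; 59; 44; 54; 31; 3; 29; 54; 38; 53; 51; 10; 53;
    33; 55; 42; 14; 40; 55; 27; 59; 57; 15; 18; 0; 6; 12; 8; 4; 35; 52; 9; 51;
    34; 37; 32; 28; 43; 39; 20; 16; 46; 58; 21; 57; 45; 26];
  [::
    48; 23; 24; 30; 50; 7; 49; 5; 51; 53; 36; 13; 49; 11; 41; 47; 56; 19; 48;
    17; 57; 58; 25; 1; 2; 22; 58; 44; 55; 31; 3; 29; 54; 38; 52; 50; 10; 53;
    33; 54; 42; 14; 40; 55; 27; 59; 56; 15; 18; 0; 6; 12; 4; 35; 52; 8; 51;
    34; 37; 9; 39; 32; 28; 43; 16; 46; 59; 20; 26; 21; 57; 45];
  [::
    48; 23; 24; 30; 50; 7; 49; 5; 51; 53; 36; 13; 49; 11; 41; 47; 56; 19; 48;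
    17; 56; 58; 25; 1; 2; 22; 59; 44; 55; 31; 3; 29; 54; 38; 52; 50; 10; 53;
    33; 54; 42; 14; 40; 55; 27; 59; 57; 15; 18; 0; 6; 12; 4; 35; 52; 8; 51;
    34; 37; 9; 39; 32; 28; 43; 20; 16; 46; 58; 21; 57; 45; 26];
  [::
    48; 23; 50; 24; 30; 7; 49; 5; 35; 58; 57; 13; 49; 11; 56; 43; 37; 19; 48;
    17; 36; 53; 51; 1; 3; 50; 52; 40; 54; 31; 4; 29; 55; 46; 58; 8; 20; 16;
    42; 54; 27; 53; 38; 15; 56; 59; 33; 55; 18; 0; 6; 12; 25; 2; 22; 52; 26;
    51; 21; 41; 28; 39; 47; 32; 44; 14; 10; 59; 9; 34; 45; 57];
  [::
    48; 23; 24; 30; 50; 7; 49; 5; 50; 52; 36; 13; 49; 11; 41; 47; 56; 19; 48;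
    17; 56; 58; 25; 1; 2; 22; 59; 44; 55; 31; 3; 29; 54; 38; 53; 51; 10; 53;
    33; 54; 42; 14; 40; 55; 27; 59; 57; 15; 18; 0; 6; 12; 8; 4; 35; 52; 9; 51;
    34; 37; 39; 32; 28; 43; 20; 16; 46; 58; 21; 57; 45; 26];
  [::
    48; 23; 50; 24; 30; 7; 49; 5; 35; 58; 57; 13; 49; 11; 56; 43; 37; 19; 48;
    17; 36; 52; 50; 1; 3; 51; 53; 40; 54; 31; 4; 29; 55; 46; 58; 8; 20; 16;
    42; 54; 27; 53; 38; 15; 56; 59; 33; 55; 18; 0; 6; 12; 2; 22; 52; 25; 51;
    21; 41; 26; 28; 39; 47; 32; 44; 14; 10; 59; 9; 34; 45; 57];
  [::
    48; 23; 50; 24; 30; 7; 49; 5; 35; 58; 56; 13; 49; 11; 56; 43; 37; 19; 48;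
    17; 36; 52; 50; 1; 3; 51; 53; 40; 54; 31; 4; 29; 55; 46; 59; 8; 20; 16;
    42; 54; 27; 53; 38; 15; 57; 59; 33; 55; 18; 0; 6; 12; 2; 22; 52; 25; 51;
    21; 41; 26; 28; 39; 47; 32; 14; 10; 58; 44; 57; 9; 34; 45];
  [::
    48; 51; 53; 23; 24; 7; 49; 5; 29; 36; 31; 13; 49; 11; 30; 19; 52; 50; 53;
    15; 35; 42; 25; 3; 4; 22; 47; 54; 37; 8; 14; 10; 41; 56; 43; 20; 9; 28;
    54; 58; 57; 32; 21; 34; 56; 59; 55; 26; 50; 0; 6; 12; 48; 17; 52; 1; 51;
    16; 18; 2; 38; 27; 46; 58; 44; 33; 40; 59; 39; 55; 45; 57];
  [::
    48; 51; 53; 23; 24; 7; 49; 5; 29; 36; 31; 13; 49; 11; 30; 19; 52; 50; 53;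
    15; 35; 42; 25; 3; 4; 22; 47; 54; 37; 8; 14; 10; 41; 56; 43; 20; 9; 28;
    55; 58; 56; 32; 21; 34; 57; 59; 54; 26; 50; 0; 6; 12; 48; 17; 52; 1; 51;
    16; 18; 2; 27; 46; 59; 38; 33; 40; 58; 44; 57; 39; 55; 45]].

(* For the leaves of [clar_leaves] below with 72 points, in order: the number of the
   graph, the image of the point [(0, 0)], and the orientation. *)
Definition clar_roots : seq (nat * (nat * nat) * bool) := [::
  (7, (48, 0), true); (8, (48, 0), true); (10, (48, 0), true);
  (11, (48, 0), true); (8, (49, 12), true); (9, (48, 0), true);
  (11, (49, 12), true); (13, (48, 0), true); (11, (49, 6), false);
  (10, (48, 18), false); (8, (49, 6), false); (7, (48, 18), false);
  (13, (48, 18), false); (11, (48, 18), false); (9, (48, 18), false);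
  (8, (48, 18), false); (15, (48, 0), true); (14, (48, 0), true);
  (13, (54, 39), false); (11, (55, 28), false); (3, (48, 0), true);
  (2, (48, 0), true); (4, (48, 0), true); (3, (50, 22), true);
  (5, (48, 18), false); (3, (53, 36), false); (6, (48, 18), false);
  (1, (48, 18), false); (1, (50, 2), false); (3, (56, 10), false);
  (6, (50, 2), false); (5, (50, 2), false); (3, (48, 18), false);
  (2, (48, 18), false); (4, (48, 18), false); (3, (50, 2), false);
  (11, (55, 43), true); (13, (54, 32), true); (14, (48, 18), false);
  (15, (48, 18), false); (14, (49, 12), true); (12, (48, 0), true);
  (11, (54, 39), false); (10, (54, 39), false); (1, (52, 4), false);
  (3, (54, 20), false); (3, (49, 6), false); (2, (49, 6), false);
  (6, (52, 4), false); (4, (52, 4), false); (5, (49, 6), false);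
  (3, (52, 4), false); (0, (0, 48), false); (1, (58, 38), false);
  (1, (51, 30), false); (3, (57, 43), false); (1, (52, 29), true);
  (3, (54, 16), true); (3, (49, 12), true); (2, (49, 12), true);
  (10, (54, 32), true); (11, (54, 32), true); (12, (48, 18), false);
  (14, (49, 6), false); (7, (51, 8), true); (8, (51, 8), true);
  (10, (51, 8), true); (11, (51, 8), true); (10, (52, 34), true);
  (11, (52, 34), true); (12, (51, 22), false); (14, (57, 10), false);
  (15, (51, 25), true); (14, (51, 25), true); (13, (51, 35), false);
  (11, (57, 46), false); (13, (52, 9), false); (11, (58, 21), false);
  (9, (51, 35), false); (8, (57, 46), false); (17, (48, 0), true);
  (16, (1, 0), false); (8, (56, 16), true); (9, (50, 4), true);
  (11, (59, 26), true); (13, (53, 37), true); (11, (56, 16), true);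
  (13, (50, 4), true); (14, (50, 2), false); (15, (50, 2), false);
  (14, (56, 14), true); (12, (50, 2), true); (11, (53, 37), false);
  (10, (53, 37), false); (11, (50, 4), false); (10, (50, 4), false);
  (8, (50, 4), false); (7, (50, 4), false); (16, (2, 3), true);
  (17, (49, 6), false); (7, (50, 35), true); (8, (50, 35), true);
  (10, (53, 9), true); (11, (53, 9), true); (10, (50, 35), true);
  (11, (50, 35), true); (12, (50, 25), false); (14, (56, 44), false);
  (15, (50, 22), true); (14, (50, 22), true); (13, (53, 34), false);
  (11, (59, 45), false); (13, (50, 8), false); (11, (56, 20), false);
  (9, (50, 8), false); (8, (56, 20), false); (17, (49, 12), true);
  (16, (2, 53), false); (17, (50, 17), true); (16, (50, 48), false);
  (8, (57, 58), true); (9, (51, 52), true); (11, (57, 58), true);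
  (13, (51, 52), true); (11, (58, 57), true); (13, (52, 51), true);
  (14, (51, 52), false); (15, (51, 52), false); (14, (57, 59), true);
  (12, (51, 52), true); (11, (51, 52), false); (10, (51, 52), false);
  (11, (52, 51), false); (10, (52, 51), false); (8, (51, 52), false);
  (7, (51, 52), false); (16, (1, 51), true); (17, (48, 50), false);
  (16, (50, 48), false); (17, (50, 48), false)].

Definition gluing_rows (g : seq nat) : seq (seq nat) :=
  [seq [:: nth 0 g v; if eqn (v %% 6) 5 then v - 5 else v.+1;
           if eqn (v %% 6) 0 then v + 5 else v.-1] | v <- iota 0 48] ++
  [seq [:: mate v; nth 0 g (v.*2 - 48); nth 0 g (v.*2 - 47)] | v <- iota 48 12].

Definition clar_rows i := gluing_rows (nth [::] clar_gluings i).

(* [trace] extends to all points of [T] the orientation-preserving ([direct = true]) or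
   reversing map of [T] into the graph of [rows] that sends one point to a given
   dart; whether the result is an isomorphism is decided by [vertex_map_ok]. *)
Section Trace.
Variables (T : table) (rows : seq (seq nat)) (direct : bool).

Definition turn_code (p : nat * nat) :=
  let s := nth [::] rows p.1 in
  (p.1, if direct then nxt s p.2 else nxt s (nxt s p.2)).

Definition traced (acc : seq (seq (option point))) (p : point) :=
  nth None (nth [::] acc p.1) p.2.

Fixpoint trace k (todo : seq (point * (nat * nat))) acc :=
  if k is k'.+1 then
    if todo is (p, d) :: todo' then
      if isSome (traced acc p) then trace k' todo' acc else
      let q := after T p in
      let t := turn_code d in
      (* This mirrors [next_link]: at an exit the next link leaves the same vertex, otherwise one
         edge has to be traversed. *)
      let dq := if exit T q then t else turn_code (t.2, t.1) in
      trace k'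
        ((q, dq) :: (if partner T p is Some p' then (p', (d.2, d.1)) :: todo' else todo'))
        (put acc p (Some d))
    else acc
  else acc.

Definition vertex_image acc p := if traced acc p is Some d then d.1 else 0.

End Trace.

(** The test asks that the map on points be constant across exits, preserve adjacency and be onto.
    For cubic graphs of equal order this yields an isomorphism, whichever orientation was traced. *)
Definition vertex_map_ok n (rows : seq (seq nat)) T (c : point -> nat) :=
  all (fun p => let q := after T p in
    if c p < n then
      (if (if exit T q then eqn (c q) (c p) else c q \in nth [::] rows (c p))
       then (if partner T p is Some p' then c p' \in nth [::] rows (c p) else false)
       else false)
    else false) (points T) &&
  all (fun v => has (fun p => eqn (c p) v) (points T)) (iota 0 n).

(** Each traced point adds at most two entries to the list, so 300 steps exhaust it for the 72
    points of a leaf. *)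
Definition rooted_iso n rows T d direct :=
  vertex_map_ok n rows T (vertex_image (trace T rows direct 300 [:: ((0, 0), d)] [::])).

Definition clar_types := [:: (6, false); (4, false); (4, true)].
Definition clar_lim s := if eqn s 6 then 8 else if eqn s 4 then 6 else 0.
(** An extremal graph has exits, so the root can be an edge with an exit at position 0. Each step
    glues one pair and at most 72 half-links are available, so 40 exceeds the 36 possible
    gluings. *)
Definition clar_leaves := search clar_types clar_lim 40 (root (4, true)).

Lemma clar_leavesE : clar_leaves = search clar_types clar_lim 40 (root (4, true)).
Proof. by []. Qed.

Definition ipr_types := [:: (5, false)].
Definition ipr_lim s := if eqn s 5 then 12 else 0.
Definition ipr_leaves := search ipr_types ipr_lim 40 (root (5, false)).

Lemma ipr_leavesE : ipr_leaves = search ipr_types ipr_lim 40 (root (5, false)).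
Proof. by []. Qed.

Definition leaf_closed T := nilp (open_points T) && ~~ nilp (points T).

Definition leaf_size k T := eqn (size (points T)) k.

Definition leaf_iso T (r : nat * (nat * nat) * bool) :=
  (r.1.1 < 18) && rooted_iso 60 (clar_rows r.1.1) T r.1.2 r.2.

Lemma clar_tables : all (fun g => let T := gluing_rows g in
  [&& cubic_table 60 T, fullerene_table 60 T & clar_table 60 T]) clar_gluings.
Proof. by vm_compute. Qed.

Lemma clar_tables_distinct :
  uniq [seq pent_walks_table 60 (gluing_rows g) | g <- clar_gluings].
Proof. by vm_compute. Qed.

Lemma buckminster_isolated : isolated_table 60 (clar_rows 0).
Proof. by vm_compute. Qed.

(** Closedness of all leaves shows that no branch was cut off with half-links still open. Only
    leaves with 72 half-links need an isomorphism, and [clar_roots] supplies it leaf by leaf. *)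
Lemma clar_leaves_ok : all leaf_closed clar_leaves &&
  all2 leaf_iso [seq T <- clar_leaves | leaf_size 72 T] clar_roots.
Proof. by vm_compute. Qed.

Lemma ipr_leaves_ok : all (fun T => leaf_closed T &&
  rooted_iso 60 (clar_rows 0) T (0, 5) true) ipr_leaves.
Proof. by vm_compute. Qed.

(** * Classification *)

Definition table_repr T := (pieces T, gluing T, open_points T).
Definition table_of_repr x := Table x.1.1 x.1.2 x.2.
Lemma table_reprK : cancel table_repr table_of_repr.
Proof. by case. Qed.
HB.instance Definition _ := Equality.copy table (can_type table_reprK).

Lemma all2_ex (A : eqType) B (Q : A -> B -> bool) s rs x :
  all2 Q s rs -> x \in s -> exists b, Q x b.
Proof.
elim: s rs => [|y s IH] [|b rs] //= /andP [q /IH IHs].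
by rewrite inE => /orP [/eqP -> |/IHs //]; exists b.
Qed.

Lemma all_filter2_ex (A : eqType) B (P F : pred A) (Q : A -> B -> bool) s rs x :
  all P s && all2 Q [seq y <- s | F y] rs -> x \in s -> P x /\ (F x -> exists b, Q x b).
Proof.
case/andP=> /allP Ps Qs xs; split=> [|Fx]; first exact: Ps.
by apply: (all2_ex Qs); rewrite mem_filter Fx.
Qed.

Lemma map_uniq_inj A (B : eqType) (x0 : A) (f : A -> B) s i j : uniq (map f s) ->
  i < size s -> j < size s -> f (nth x0 s i) = f (nth x0 s j) -> i = j.
Proof.
move=> U si sj E; apply/eqP; rewrite -(nth_uniq (f x0) _ _ U) ?size_map //.
by rewrite !(nth_map x0) // E.
Qed.

Lemma clar_rows_distinct i j : i < 18 -> j < 18 ->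
  pent_walks_table 60 (clar_rows i) = pent_walks_table 60 (clar_rows j) -> i = j.
Proof. exact: map_uniq_inj clar_tables_distinct. Qed.

Lemma clar_rows_ok i : i < 18 -> [/\ cubic_table 60 (clar_rows i),
  fullerene_table 60 (clar_rows i) & clar_table 60 (clar_rows i)].
Proof.
move=> i18; have /allP/(_ (nth [::] clar_gluings i)) := clar_tables.
by rewrite mem_nth // => /(_ isT) /and3P.
Qed.

Lemma clar_leavesP T : T \in search clar_types clar_lim 40 (root (4, true)) ->
  leaf_closed T /\ (leaf_size 72 T -> exists x, leaf_iso T x).
Proof. by rewrite -clar_leavesE; apply: all_filter2_ex clar_leaves_ok. Qed.

Lemma ipr_leavesP T : T \in search ipr_types ipr_lim 40 (root (5, false)) ->
  leaf_closed T && rooted_iso 60 (clar_rows 0) T (0, 5) true.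
Proof. by rewrite -ipr_leavesE; apply: (allP ipr_leaves_ok). Qed.

Section Classify.
Variable G : embedded_graph.
Hypothesis cubicG : cubic G.
Hypothesis connG : connected G.

Local Notation dt := (dart G).
Local Notation r := (rotation G).
Local Notation e := (@rev_dart G).
Local Notation phi := (face_perm G).

Variables C mt : pred dt.
Hypothesis coverG : face_cover C mt.
Local Notation K := (link_dart C mt).
Local Notation X := (exit_dart C mt).
Local Notation sigma := (next_link C mt).
Variable c : nat.
Hypothesis C_size : forall d, C d -> #|porbit phi d| = c.
Hypothesis c4 : c != 4.
Hypothesis exit_uniq : forall q q', X q -> X q' -> porbit phi q = porbit phi q' -> q = q'.
Hypothesis link_face : forall d, K d -> #|porbit phi d| = 5 \/
  #|porbit phi d| = 6 /\ forall q, q \in porbit phi d -> ~~ X q.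
Local Notation sz := (link_size C c).
Local Notation realizes := (realizes e sigma K X sz).

Variables (types : seq (nat * bool)) (lim : nat -> nat).
Hypothesis K_types : forall d, K d -> (sz d, X d) \in types.
Hypothesis K_lim : forall s, #|[set d | K d && (sz d == s)]| <= s * lim s.

Lemma link_leaf d fuel s b : K d -> sz d = s -> X d = b -> exists T m,
  realizes T m /\ T \in search types lim fuel (root (s, b)).
Proof.
move=> kd sE bE.
(* By [c4] the size 4 singles out the matching edges among the pieces. *)
have sz4 x : sz x = 4 -> ~~ covered C (src x).
  by rewrite /link_size; case: ifP => // _ /eqP; rewrite (negbTE c4).
have period := next_period cubicG coverG C_size.
have kn := link_next cubicG coverG.
have kr x : K x -> K (e x) by rewrite (link_rev coverG).
have rn x : e x <> x by apply: rev_neq.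
have sn x : K x -> sz (sigma x) = sz x by apply: link_size_next.
have xs x : K x -> sz x = 4 -> X (sigma x) = ~~ X x.
  by move=> kx /sz4 nc; rewrite (exit_next cubicG coverG kx) nc.
have xz x : K x -> X x -> sz x = 4.
  by move=> kx xx; rewrite /link_size (negbTE (exit_covered cubicG coverG xx)).
have s0 := link_size_gt0 cubicG coverG C_size.
have t3 := triangle3 cubicG coverG exit_uniq link_face.
have tn := triangle_neq link_face.
have tx := triangle_exit exit_uniq link_face.
have per1 x : K x -> iter (sz x) sigma x = x by case/period.
have per2 x j : K x -> 0 < j < sz x -> iter j sigma x <> x by case/period => _; apply.
have [m R] := @real_root _ e sigma K X sz kn sn xs xz per1 per2 d kd.
rewrite sE bE in R.
(* Being one of the leaves is itself the predicate passed to [search_realizes]. *)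
have sub : all (mem (search types lim fuel (root (s, b))))
    (search types lim fuel (root (s, b))) by apply/allP.
have [T [m' [R' T_in]]] := search_realizes (@rev_dartK _) kr rn kn sn xs xz per1 per2 s0
  t3 tn tx K_types K_lim R sub.
by exists T, m'.
Qed.

Section Leaf.
Variables (T : table) (m : point -> dart G).
Hypothesis R : realizes T m.
Hypothesis closedT : leaf_closed T.

Lemma leaf_open : open_points T = [::].
Proof. by case/andP: closedT => /nilP. Qed.

Lemma leaf_points : points T != [::].
Proof. by case/andP: closedT => _; case: (points T). Qed.

Lemma leaf_connected (P : pred dt) :
  (forall d, K d -> P d -> P (e d) /\ P (sigma d)) ->
  (exists2 d, K d & P d) -> forall d, K d -> P d.
Proof. exact: (link_connected cubicG coverG C_size). Qed.

Lemma leaf_card : size (points T) = #|[set d | K d]|.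
Proof. exact: (real_card R leaf_open leaf_connected leaf_points). Qed.

Lemma leaf_onto d : K d -> exists2 p, valid T p & m p = d.
Proof. exact: (real_onto R leaf_open leaf_connected leaf_points). Qed.

Section LeafIso.
Variables (n : nat) (rows : seq (seq nat)).
Hypothesis cubicT : cubic_table n rows.
Hypothesis cardG : #|G| = n.
Variable f : point -> nat.
Hypothesis fok : vertex_map_ok n rows T f.

Lemma leaf_map_lt p : valid T p -> f p < n.
Proof.
case/andP: fok => /allP h _; rewrite -mem_points => /h /=.
by case: ifP.
Qed.

Lemma leaf_map_step p : valid T p ->
  if exit T (after T p) then f (after T p) = f p
  else f (after T p) \in nth [::] rows (f p).
Proof.
case/andP: fok => /allP h _; rewrite -mem_points => /h /=.
by case: ifP => // _; case: ifP => // + _; case: ifP => // _; rewrite eqnE => /eqP.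
Qed.

Lemma leaf_map_partner p q : valid T p -> partner T p = Some q ->
  f q \in nth [::] rows (f p).
Proof.
case/andP: fok => /allP h _; rewrite -mem_points => /h /= + E.
by rewrite E; do 2!case: ifP => // _.
Qed.

(** Distinct links at one vertex are consecutive around an exit, and there [vertex_map_ok] demands
    equal images; thus [f] descends from points to vertices. *)
Lemma leaf_map_src p q : valid T p -> valid T q -> src (m p) = src (m q) -> f p = f q.
Proof.
move=> vp vq s; have kp := real_K R vp; have kq := real_K R vq.
have inj := real_inj R; have aft := real_after R; have ex := real_X R.
have step x y : valid T x -> valid T y -> m y = sigma (m x) -> X (sigma (m x)) -> f y = f x.
  move=> vx vy myx xs; have yE : y = after T x.
    by apply: inj => //; rewrite ?valid_after // aft.
  by have := leaf_map_step vx; rewrite -ex ?valid_after // aft // xs yE.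
have [E|[E x]|[E x]] := link_src cubicG kq kp s.
- by congr f; apply: inj.
- exact: step E x.
- by symmetry; apply: step E x.
Qed.

Lemma leaf_dart v : exists p, valid T p && (src (m p) == v).
Proof.
have [d kd sd] := link_ex cubicG coverG v; have [p vp mp] := leaf_onto kd.
by exists p; rewrite vp mp sd eqxx.
Qed.

Definition leaf_vertex v : point := xchoose (leaf_dart v).

Lemma leaf_vertex_valid v : valid T (leaf_vertex v).
Proof. by case/andP: (xchooseP (leaf_dart v)). Qed.

Lemma leaf_vertex_src v : src (m (leaf_vertex v)) = v.
Proof. by case/andP: (xchooseP (leaf_dart v)) => _ /eqP. Qed.

Definition leaf_image v : 'I_n := Ordinal (leaf_map_lt (leaf_vertex_valid v)).

Lemma leaf_imageE p : valid T p -> val (leaf_image (src (m p))) = f p.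
Proof.
by move=> vp; apply: leaf_map_src; rewrite ?leaf_vertex_src ?leaf_vertex_valid.
Qed.

Lemma leaf_image_bij : bijective leaf_image.
Proof.
apply: inj_card_bij; last by rewrite card_ord cardG.
suff /image_injP inj : #|codom leaf_image| == #|{: G}| by move=> u v; apply: inj.
have -> : #|codom leaf_image| = #|{: 'I_n}|; last by rewrite card_ord cardG.
apply: eq_card => i; rewrite inE; apply/codomP.
case/andP: fok => _ /allP /(_ i); rewrite mem_iota ltn_ord => /(_ isT) /hasP [p].
rewrite mem_points eqnE => vp /eqP fp; exists (src (m p)); apply: val_inj.
by rewrite leaf_imageE.
Qed.

(** By [edge_link] every edge is a glued pair or a step of [after] that is not an exit, and
    [vertex_map_ok] sends both to edges. *)
Lemma leaf_graph_iso : graph_iso G (table_graph cubicT).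
Proof.
apply: (@graph_iso_of_hom _ (table_graph cubicT) leaf_image cubicG).
- exact: table_cubic.
- exact: leaf_image_bij.
have sym x y : @adj (table_graph cubicT) x y -> @adj (table_graph cubicT) y x.
  by rewrite adj_sym.
have hom_s k : K k -> src (sigma k) != src k ->
    @adj (table_graph cubicT) (leaf_image (src k)) (leaf_image (src (sigma k))).
  move=> kk sk; have [p vp mp] := leaf_onto kk; subst k.
  have va := valid_after vp; have mE := real_after R vp.
  have := leaf_map_step vp; rewrite -(real_X R) // mE; case: ifP => [x _|_].
    by rewrite (src_exit cubicG coverG kk x) eqxx in sk.
  by rewrite /= /table_adj leaf_imageE // -mE leaf_imageE.
move=> x y xy; pose d := exist _ (x, y) xy : dt.
have xyN : x != y := src_neq_tgt d.
have [kd|[k [kk s1 s2]]|[k [kk s1 s2]]] := edge_link cubicG coverG d.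
- have [p vp mp] := leaf_onto kd; have [q E] := real_complete R leaf_open vp.
  have [_ vq mq] := real_partner R E; have := leaf_map_partner vp E.
  rewrite -!leaf_imageE // mq mp; exact.
- by rewrite -[x]/(src d) -[y]/(tgt d) -s1 -s2; apply: hom_s; rewrite // s1 s2 eq_sym.
- by apply: sym; rewrite -[x]/(src d) -[y]/(tgt d) -s1 -s2; apply: hom_s; rewrite // s1 s2.
Qed.
End LeafIso.
End Leaf.
End Classify.

(** * Sextet patterns and isolated pentagons in fullerenes with 60 vertices *)

Section Fullerene.
Variable G : embedded_graph.
Hypothesis fullG : fullerene60 G.

Local Notation dt := (dart G).
Local Notation r := (rotation G).
Local Notation e := (@rev_dart G).
Local Notation phi := (face_perm G).

Lemma full_cubic : cubic G.
Proof. by case/andP: fullG => /and4P []. Qed.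

Lemma full_card : #|G| = 60.
Proof. by case/andP: fullG => _ /eqP. Qed.

Lemma full_connected : connected G.
Proof. by case/andP: fullG => /and4P [/andP []]. Qed.

Lemma full_faces : faces G == pentagons G :|: hexagons G.
Proof. by case/andP: fullG => /and4P []. Qed.

Lemma full_pentagons : #|pentagons G| = 12.
Proof.
apply: (card_pentagons full_cubic full_faces).
by case/andP: fullG => /and4P [].
Qed.

Lemma pentagonE d : (porbit phi d \in pentagons G) = (#|porbit phi d| == 5).
Proof. by rewrite inE imset_f. Qed.

Section SextetPattern.
Variables (H : {set {set dt}}) (M : {set {set G}}).
Hypothesis H_hex : H \subset hexagons G.
Hypothesis H_disj : forall f g, f \in H -> g \in H -> f != g ->
  [disjoint face_vertices f & face_vertices g].
Hypothesis M_perfect : perfect_matching M.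
Hypothesis H_alt : forall f, f \in H -> alternating M f.

Definition pattern_dart : pred dt := fun d => porbit phi d \in H.
Local Notation C := pattern_dart.
Definition rest_dart : pred dt := fun d => (dart_edge d \in M) && ~~ covered C (src d).
Local Notation mt := rest_dart.
Local Notation X := (exit_dart C mt).
Local Notation K := (link_dart C mt).

Lemma pattern_size d : C d -> #|porbit phi d| = 6.
Proof. by move/(subsetP H_hex); rewrite inE => /andP [_ /eqP]. Qed.

Lemma card_pattern : #|[set d | C d]| = #|H| * 6.
Proof.
apply: card_porbits_uniform.
  by apply: subset_trans H_hex _; apply/subsetP=> f; rewrite inE => /andP [].
by move=> f /(subsetP H_hex); rewrite inE => /andP [_ /eqP].
Qed.

Lemma matching_edge v E E' : E \in M -> E' \in M -> v \in E -> v \in E' -> E = E'.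
Proof.
move=> EM EM' vE vE'; have /andP [_ /forallP/(_ v)/cards1P [E0 E0P]] := M_perfect.
have h F : F \in M -> v \in F -> F = E0.
  by move=> FM vF; apply/set1P; rewrite -E0P inE FM.
by rewrite (h E) // (h E').
Qed.

Lemma src_edge (d : dt) : src d \in dart_edge d.
Proof. by rewrite !inE eqxx. Qed.

Lemma tgt_edge (d : dt) : tgt d \in dart_edge d.
Proof. by rewrite !inE eqxx orbT. Qed.

Lemma pattern_src d d' : C d -> C d' -> src d' = src d -> d' = d.
Proof.
move=> cd cd' s; apply: (face_src_inj full_cubic full_faces) => //; apply/eqP.
apply/negPn/negP=> ne; have /pred0P/(_ (src d)) := H_disj cd' cd ne.
by rewrite /= => /negP; apply; apply/andP; split; apply/imsetP;
  [exists d' | exists d]; rewrite ?porbit_id.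
Qed.

Lemma pattern_covered d : C d -> covered C (src d).
Proof. exact: cover_covered. Qed.

(* The matching edge at a vertex of a cover hexagon lies on that hexagon. *)
Lemma rest_rev d : mt d -> mt (e d).
Proof.
case/andP=> dM nc; rewrite /mt dart_edge_rev dM /=; apply: contra nc.
case/existsP=> h /andP [ch /eqP sh]; rewrite src_rev in sh.
(* [g] and [h] are the boundary edges at the covered end of [d]. Alternation puts one of them into
   [M], and uniqueness of the matching edge there identifies it with the edge of [d]. *)
have [g hE] : exists g, phi g = h by exists ((phi^-1)%g h); rewrite permKV.
have cg : C g by rewrite /pattern_dart -(porbit_step phi g) hE.
have tg : tgt g = src h by rewrite -hE src_face.
have := H_alt cg => /forallP/(_ g); rewrite porbit_id hE /=.
case: (boolP (dart_edge g \in M)) => [gM _|_ /= hM].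
  have E : dart_edge d = dart_edge g.
    by apply: (matching_edge (v := tgt d)) => //; rewrite ?tgt_edge // -sh -tg tgt_edge.
  have [->|dE] := dart_edge_eq E; first exact: pattern_covered.
  by have := src_neq_tgt d; rewrite -sh -tg dE src_rev eqxx.
have {}hM : dart_edge h \in M by case: (_ \in M) hM.
have E : dart_edge d = dart_edge h.
  by apply: (matching_edge (v := tgt d)) => //; rewrite ?tgt_edge // -sh src_edge.
have [->|->] := dart_edge_eq E; first exact: pattern_covered.
rewrite src_rev -src_face; apply: pattern_covered.
by rewrite /pattern_dart porbit_step.
Qed.

Lemma pattern_cover : face_cover C mt.
Proof.
split=> [d|||d|d|v nc].
- by rewrite /pattern_dart porbit_step.
- exact: pattern_src.
- move=> d d' /andP [dM _] /andP [dM' _] s.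
  have E : dart_edge d' = dart_edge d.
    by apply: (matching_edge (v := src d)); rewrite ?src_edge // -s src_edge.
  have [//|dE] := dart_edge_eq E.
  by have := src_neq_tgt d; rewrite -s dE src_rev eqxx.
- exact: rest_rev.
- by case/andP.
have /andP [/subsetP Medge /forallP/(_ v)/cards1P [E EP]] := M_perfect.
have : E \in [set e in M | v \in e] by rewrite EP set11.
rewrite inE => /andP [EM vE]; have /edgesP [d dE] := Medge _ EM.
move: vE; rewrite dE !inE => /orP [] /eqP vd.
  by exists d => //; rewrite /mt -dE EM -vd.
by exists (e d) => //; rewrite /mt dart_edge_rev -dE EM src_rev -vd.
Qed.

Local Notation exits := [set q | X q].

Lemma card_exits : #|exits| + #|H| * 6 = 60.
Proof. by rewrite -card_pattern (card_exit full_cubic pattern_cover) full_card. Qed.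

Lemma pentagons_exit : pentagons G \subset porbit phi @: exits.
Proof.
apply/subsetP=> f; rewrite inE => /andP [fF /eqP f5].
have [d _ fE] := imsetP fF; rewrite fE in f5 *.
have nc : ~~ C d by apply/negP=> /pattern_size; rewrite f5.
have [|q qd xq] := odd_face_exit full_cubic pattern_cover nc; first by rewrite f5.
apply/imsetP; exists q; rewrite ?inE //; apply/eqP.
by rewrite eq_sym -mem_porbit_eq.
Qed.

Lemma pattern_bound : #|H| <= 8.
Proof.
have := leq_trans (subset_leq_card pentagons_exit) (leq_imset_card _ _).
have := card_exits; rewrite full_pentagons; lia.
Qed.

Section Extremal.
Hypothesis H8 : #|H| = 8.

Lemma exits12 : #|exits| = 12.
Proof. by have := card_exits; rewrite H8; lia. Qed.

Lemma exits_pentagons : porbit phi @: exits = pentagons G.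
Proof.
apply/esym/eqP; rewrite eqEcard pentagons_exit full_pentagons -exits12.
exact: leq_imset_card.
Qed.

Lemma extremal_exit_uniq q q' : X q -> X q' -> porbit phi q = porbit phi q' -> q = q'.
Proof.
move=> xq xq' E; have /imset_injP inj : #|porbit phi @: exits| == #|exits|.
  by rewrite exits_pentagons full_pentagons exits12.
by apply: inj; rewrite ?inE.
Qed.

Lemma extremal_link_face d : K d -> #|porbit phi d| = 5 \/
  #|porbit phi d| = 6 /\ forall q, q \in porbit phi d -> ~~ X q.
Proof.
move=> _; have [d5|d6] := face_size full_faces d; [by left|right; split=> // q qd].
apply/negP=> xq; have : porbit phi q \in pentagons G.
  by rewrite -exits_pentagons imset_f ?inE.
by rewrite pentagonE; move: qd; rewrite mem_porbit_eq => /eqP ->; rewrite d6.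
Qed.

Lemma card_rest : #|[set d | mt d]| = 12.
Proof.
by have := card_mt pattern_cover; rewrite card_pattern H8 full_card; lia.
Qed.

Lemma extremal_types d : K d -> (link_size C 6 d, X d) \in clar_types.
Proof.
move=> _; rewrite /link_size; case: (boolP (covered C _)) => cd; last by case: (X d).
case xd: (X d) => //; have := exit_covered full_cubic pattern_cover xd.
by rewrite cd.
Qed.

Lemma extremal_lim s : #|[set d | K d && (link_size C 6 d == s)]| <= s * clar_lim s.
Proof.
rewrite /link_size /clar_lim eqnE; case: eqP => [->|s6].
  have -> : 6 * 8 = #|[set d | K d && covered C (src d)]|.
    by rewrite (card_link_covered full_cubic pattern_cover) card_pattern H8.
  apply/subset_leq_card/subsetP=> d; rewrite !inE => /andP [->] /=.
  by case: ifP.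
case: eqP => [->|s4].
  have -> : 4 * 6 = #|[set d | K d && ~~ covered C (src d)]|.
    by rewrite (card_link_uncovered full_cubic pattern_cover) card_rest.
  apply/subset_leq_card/subsetP=> d; rewrite !inE => /andP [->] /=.
  by case: ifP.
rewrite muln0 leqn0 cards_eq0; apply/eqP/setP=> d; rewrite !inE.
by case: ifP => _; apply/negP=> /andP [_ /eqP E]; [case: s6 | case: s4].
Qed.

Lemma extremal_classified : exists (i : nat) (T : cubic_table 60 (clar_rows i)),
  i < 18 /\ graph_iso G (table_graph T).
Proof.
have [d0] : exists d0, d0 \in exits by apply/set0Pn; rewrite -card_gt0 exits12.
rewrite inE => x0; have k0 : K d0 by case/andP: x0.
have s0 : link_size C 6 d0 = 4.
  by rewrite /link_size (negbTE (exit_covered full_cubic pattern_cover x0)).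
have [T [m [R /clar_leavesP [cT iso]]]] := link_leaf full_cubic pattern_cover pattern_size
  isT extremal_exit_uniq extremal_link_face extremal_types extremal_lim 40 k0 s0 x0.
have [|[[i d] b] /andP [/= i18 ok]] := iso.
  rewrite /leaf_size eqnE.
  (* The 48 darts of the hexagons and the 12 of the matching give 48 + 2 * 12 = 72 links. *)
  rewrite (leaf_card full_cubic full_connected pattern_cover pattern_size R cT).
  by rewrite (card_link full_cubic pattern_cover) card_pattern card_rest H8.
have [cub _ _] := clar_rows_ok i18.
exists i, cub; split=> //.
exact: (leaf_graph_iso full_cubic full_connected pattern_cover pattern_size R cT cub
  full_card ok).
Qed.

End Extremal.
End SextetPattern.

Lemma sextet_patternP (H : {set {set dt}}) : sextet_pattern H ->
  exists M, [/\ H \subset hexagons G,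
    forall f g, f \in H -> g \in H -> f != g -> [disjoint face_vertices f & face_vertices g],
    perfect_matching M & forall f, f \in H -> alternating M f].
Proof.
case/and3P=> sub /forallP dis /existsP [M /andP [pM /forallP alt]]; exists M; split=> //.
  move=> f g fH gH; have := dis f; rewrite fH => /forallP/(_ g).
  by rewrite gH /= => /implyP.
by move=> f fH; have := alt f; rewrite fH.
Qed.

Lemma clar_le8 : clar_number G <= 8.
Proof.
apply/bigmax_leqP=> H /sextet_patternP [M [sub dis pM alt]].
exact: (pattern_bound sub dis pM alt).
Qed.

(** * Uniqueness of the fullerene with isolated pentagons *)

Section Isolated.
Hypothesis isoG : isolated_pentagons G.

Definition pent_dart : pred dt := fun d => #|porbit phi d| == 5.
Local Notation C := pent_dart.
Local Notation K := (link_dart C pred0).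

(** [r d] follows [e d] on its face, so the edge of [d] would be shared by two pentagons, which
    differ by [face_rev]. *)
Lemma pent_rot d : C d -> C (r d) = false.
Proof.
move=> cd; apply/negP=> cr.
have pd : porbit phi d \in pentagons G by rewrite pentagonE.
have pr : porbit phi (r d) \in pentagons G by rewrite pentagonE.
have oe : porbit phi (r d) = porbit phi (e d).
  by rewrite -(porbit_step phi (e d)) face_permE revK.
have /forallP/(_ (porbit phi d)) := isoG; rewrite pd => /forallP/(_ (porbit phi (r d))).
rewrite pr oe (eq_sym (porbit phi d)) (face_rev full_cubic full_faces) /= => /pred0P.
move/(_ (dart_edge d)); rewrite /= => /negP; apply; apply/andP.
split; apply/imsetP; first by exists d; rewrite ?porbit_id.
by exists (e d); rewrite ?porbit_id ?dart_edge_rev.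
Qed.

Lemma pent_src d d' : C d -> C d' -> src d' = src d -> d' = d.
Proof.
move=> cd cd' /(same_src full_cubic) [//|E|E].
  by rewrite E pent_rot in cd'.
by have := pent_rot cd'; rewrite E (rot3 full_cubic) cd.
Qed.

Lemma card_pent_darts : #|[set d | C d]| = 60.
Proof. by rewrite -card_porbits_size full_pentagons. Qed.

(** The 12 * 5 pentagon darts have distinct sources, as many as there are vertices. *)
Lemma pent_covered v : covered C v.
Proof.
have : [set v | covered C v] == [set: G].
  by rewrite eqEcard subsetT cardsT (card_covered pent_src) card_pent_darts full_card.
by move/eqP/setP/(_ v); rewrite !inE.
Qed.

Lemma pent_cover : face_cover C pred0.
Proof.
split=> // [d||v]; [by rewrite /pent_dart porbit_step | exact: pent_src |].
by rewrite pent_covered.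
Qed.

Lemma pent_exit q : exit_dart C pred0 q = false.
Proof.
apply/negP=> /(exit_covered full_cubic pent_cover).
by rewrite pent_covered.
Qed.

Lemma isolated_classified (T : cubic_table 60 (clar_rows 0)) : graph_iso G (table_graph T).
Proof.
have size5 d : C d -> #|porbit phi d| = 5 by move/eqP.
have exit_uniq q q' : exit_dart C pred0 q -> exit_dart C pred0 q' ->
  porbit phi q = porbit phi q' -> q = q' by rewrite pent_exit.
have face d : K d -> #|porbit phi d| = 5 \/
    #|porbit phi d| = 6 /\ forall q, q \in porbit phi d -> ~~ exit_dart C pred0 q.
  move=> _; have [d5|d6] := face_size full_faces d; [by left|right; split=> // q _].
  by rewrite pent_exit.
have types d : K d -> (link_size C 5 d, exit_dart C pred0 d) \in ipr_types.
  by move=> _; rewrite /link_size pent_covered pent_exit.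
have cardK : #|[set d | K d]| = 60.
  rewrite (card_link full_cubic pent_cover) card_pent_darts.
  by rewrite (_ : [set d | pred0 d] = set0) ?cards0 //; apply/setP=> d; rewrite !inE.
have lim s : #|[set d | K d && (link_size C 5 d == s)]| <= s * ipr_lim s.
  rewrite /ipr_lim eqnE; case: eqP => [->|s5].
    rewrite -[5 * 12]/60 -cardK; apply/subset_leq_card/subsetP=> d.
    by rewrite !inE => /andP [].
  rewrite muln0 leqn0 cards_eq0; apply/eqP/setP=> d; rewrite !inE /link_size pent_covered.
  by rewrite (introF eqP) ?andbF // => E; case: s5.
have [d0 k0] : exists d0, d0 \in [set d | K d] by apply/set0Pn; rewrite -card_gt0 cardK.
rewrite inE in k0; have s0 : link_size C 5 d0 = 5 by rewrite /link_size pent_covered.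
have [T' [m [R /ipr_leavesP /andP [cT ok]]]] := link_leaf full_cubic pent_cover size5 isT
  exit_uniq face types lim 40 k0 s0 (pent_exit d0).
exact: (leaf_graph_iso full_cubic full_connected pent_cover size5 R cT T full_card ok).
Qed.
End Isolated.
End Fullerene.

Lemma clar_rows_cubic (i : 'I_18) : cubic_table 60 (clar_rows i).
Proof. by case: (clar_rows_ok (ltn_ord i)). Qed.

Theorem theorem4p10 :
  exists F : 'I_18 -> embedded_graph,
    [/\ forall i : 'I_18, extremal60 (F i),
        forall i j : 'I_18, graph_iso (F i) (F j) -> i = j,
        forall G : embedded_graph, extremal60 G ->
          exists i : 'I_18, graph_iso G (F i)
      & exists i : 'I_18, is_buckminsterfullerene (F i)].
Proof.
pose F (i : 'I_18) := table_graph (clar_rows_cubic i).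
have full i : fullerene60 (F i).
  by apply: table_fullerene60; case: (clar_rows_ok (ltn_ord i)).
exists F; split=> [i|i j|G|].
- rewrite /extremal60 full /= eqn_leq clar_le8 //=.
  have [_ _ cT] := clar_rows_ok (ltn_ord i).
  have [H patH H8] := table_clar (clar_rows_cubic i) cT.
  by rewrite -[(60 - 12) %/ 6]/8 -H8; apply: leq_bigmax_cond.
- move/graph_iso_pent_walks; rewrite !pent_walks_tableE => E.
  have ij := clar_rows_distinct (ltn_ord i) (ltn_ord j) E.
  by apply: val_inj.
- case/andP=> fullG /eqP clar8.
  have [H patH H8] : exists2 H : {set {set dart G}}, sextet_pattern H & #|H| = 8.
    (* If no pattern had more than 7 hexagons, the maximum would be at most 7; [pattern_bound] then
       turns more than 7 into exactly 8. *)
    have [/existsP [H /andP [pH H7]]|/existsPn no] :=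
        boolP [exists H : {set {set dart G}}, sextet_pattern H && (7 < #|H|)]; last first.
      have : clar_number G <= 7; last by rewrite clar8.
      by apply/bigmax_leqP=> H pH; have := no H; rewrite pH /= -leqNgt.
    exists H => //.
    have [M [sub dis pM alt]] := sextet_patternP pH.
    by have := pattern_bound fullG sub dis pM alt; lia.
  have [M [sub dis pM alt]] := sextet_patternP patH.
  have [i [T [i18 iso]]] := extremal_classified fullG sub dis pM alt H8.
  exists (Ordinal i18); rewrite /F.
  by rewrite (bool_irrelevance (clar_rows_cubic (Ordinal i18)) T).
exists ord0; split; first exact: full.
  apply: table_isolated; last exact: buckminster_isolated.
  by case: (clar_rows_ok (ltn_ord (ord0 : 'I_18))).
by move=> G fullG isoG; apply: isolated_classified.
Qed.
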